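(* Let $W\in\tilde{\mathcal W}_q(\mathbf G^* )$. Then for subsets $S\subseteq\mathbf G\setminus\{0\}$ one has $$\inf\{\|A-P_SA\| : A\in\mathbf M_q,\ \mathrm{tr}\,A=1\}=\|I-\tilde I_S\|_\sim^{-1}.$$
   Context: $\mathbf G$ is a discrete abelian group with neutral element $0$, $\mathbf G^*$ its compact dual group, $\lambda$ the Haar measure on $\mathbf G^*$ with $\lambda(\mathbf G^* )=1$. Integrals are over $\mathbf G^*$. For $q\in\mathbb N=\{1,2,\dots\}$, $\mathbf M_q$ is the algebra of complex $q\times q$ matrices, $I$ the identity matrix (matrices are also viewed as constant functions), $\mathrm{tr}$ the normalized trace ($\mathrm{tr}\,I=1$). $\mathcal W_q(\mathbf G^* )$ is the set of integrable functions on $\mathbf G^*$ with values in the positive (definite) Hermitian $q\times q$ matrices; $\tilde{\mathcal W}_q(\mathbf G^* )$ is the set of $W\in\mathcal W_q(\mathbf G^* )$ with $W^{-1}$ integrable. $L^2(W)$ is the left Hilbert $\mathbf M_q$-module of (classes of) measurable $F:\mathbf G^*\to\mathbf M_q$ with $\mathrm{tr}(FWF^* )$ integrable, with $\mathbf M_q$-valued inner product $(F,G)=\int FWG^*\,d\lambda$ and norm $\|F\|=(\mathrm{tr}(F,F))^{1/2}$. For $L^2(W^{-1})$ the corresponding objects are $(F,G)_\sim=\int FW^{-1}G^*\,d\lambda$ and $\|F\|_\sim=(\mathrm{tr}(F,F)_\sim)^{1/2}$. For $S\subseteq\mathbf G$, $\mathcal T(S)$ is the left $\mathbf M_q$-module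 of all $\mathbf M_q$-valued trigonometric polynomials with frequencies in $S$ (finite sums $\sum_{g\in S}A_g\chi_g$, $A_g\in\mathbf M_q$, $\chi_g$ the character of $\mathbf G^*$ defined by $g$; $\mathcal T(\emptyset)=\{0\}$), $\mathcal M(S)$ is its closure in $L^2(W)$, $P_S$ is the orthogonal projection of $L^2(W)$ onto $\mathcal M(S)$, and $S^0=S\cup\{0\}$. For a submodule $\mathcal M$ of $L^2(W)$, its dual is $\mathcal M^d=\{G\in L^2(W^{-1}):\int FG^*\,d\lambda=0\text{ for all }F\in\mathcal M\}$. $\tilde I_S$ denotes the orthogonal projection, in $L^2(W^{-1})$, of $I$ onto $\mathcal M(S^0)^d$. *)

(* Defs.v *)
From HB Require Import structures.
From mathcomp Require Import all_boot all_order all_algebra complex.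
From mathcomp Require Import all_classical all_reals all_analysis.

Set Implicit Arguments.
Unset Strict Implicit.
Unset Printing Implicit Defensive.

Import Order.TTheory GRing.Theory Num.Theory.
Import numFieldNormedType.Exports.

Local Open Scope classical_set_scope.
Local Open Scope ring_scope.
Local Open Scope complex_scope.
Local Open Scope sesquilinear_scope.

(* A discrete abelian group is a bare [zmodType]; since it is discrete, every
   homomorphism to the unit circle is continuous. *)
Record dual (R : realType) (G : zmodType) : Type := Character {
  char_fun :> G -> R[i];
  char_norm1 : forall g, `|char_fun g| = 1;
  char_morph : forall g h, char_fun (g + h) = char_fun g * char_fun h }.

Lemma char_one_norm1 (R : realType) (G : zmodType) (g : G) :
  `|(fun _ : G => 1 : R[i]) g| = 1.
Proof. exact: normr1. Qed.

Lemma char_one_morph (R : realType) (G : zmodType) (g h : G) :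
  (fun _ : G => 1 : R[i]) (g + h) =
  (fun _ : G => 1 : R[i]) g * (fun _ : G => 1 : R[i]) h.
Proof. by rewrite mulr1. Qed.

Definition dual_one (R : realType) (G : zmodType) : dual R G :=
  Character (@char_one_norm1 R G) (@char_one_morph R G).

Lemma char_mul_norm1 (R : realType) (G : zmodType) (x y : dual R G) (g : G) :
  `|x g * y g| = 1.
Proof. by rewrite normrM !char_norm1 mulr1. Qed.

Lemma char_mul_morph (R : realType) (G : zmodType) (x y : dual R G) (g h : G) :
  x (g + h) * y (g + h) = (x g * y g) * (x h * y h).
Proof. by rewrite !char_morph mulrACA. Qed.

Definition dual_mul (R : realType) (G : zmodType) (x y : dual R G) : dual R G :=
  Character (char_mul_norm1 x y) (char_mul_morph x y).

HB.instance Definition _ (R : realType) (G : zmodType) :=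
  gen_eqMixin (dual R G).
HB.instance Definition _ (R : realType) (G : zmodType) :=
  gen_choiceMixin (dual R G).
HB.instance Definition _ (R : realType) (G : zmodType) :=
  isPointed.Build (dual R G) (dual_one R G).

(* [R[i]^o] carries the usual topology of the complex plane and [{ptws _ -> _}]
   that of pointwise convergence, which on the dual of a discrete group is the
   compact-open topology. *)
Definition dual_eval (R : realType) (G : zmodType) (x : dual R G) :
  {ptws G -> (R[i])^o} := char_fun x.

HB.instance Definition _ (R : realType) (G : zmodType) :=
  Topological.copy (dual R G) (initial_topology (@dual_eval R G)).

(* The dual group with its Borel sigma-algebra; as a type it is [dual R G]. *)
Definition borel_dual (R : realType) (G : zmodType) :=
  g_sigma_algebraType (@open (dual R G)).

(* The normalization of the total mass to 1 is part of [probability].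
   Regularity is part of the notion of a Haar measure: for uncountable groups
   it is not automatic. *)
Definition haar (R : realType) (G : zmodType)
    (mu : probability (borel_dual R G) R) : Prop :=
  [/\ forall (x : dual R G) (A : set (borel_dual R G)), measurable A ->
        mu [set dual_mul x y | y in A] = mu A,
      forall A : set (borel_dual R G), measurable A ->
        mu A = ereal_inf
          [set mu U | U in [set U : set (dual R G) | open U /\ A `<=` U]]
    & forall U : set (dual R G), open U ->
        mu U = ereal_sup
          [set mu K | K in [set K : set (dual R G) | compact K /\ K `<=` U]] ].

Definition ntr (C : fieldType) (q : nat) (A : 'M[C]_q) : C := \tr A / q%:R.

(* The order of [R[i]] is partial: [0 < z] says that z is real and positive. *)
Definition posdefmx (R : realType) (q : nat) (A : 'M[R[i]]_q) : Prop :=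
  A \is hermsymmx /\
  forall v : 'rV[R[i]]_q, v != 0 -> 0 < (v *m A *m v ^t*) 0 0.

Definition cintegrable d (T : measurableType d) (R : realType)
    (mu : {measure set T -> \bar R}) (f : T -> R[i]) : Prop :=
  mu.-integrable setT (fun x => (complex.Re (f x))%:E) /\
  mu.-integrable setT (fun x => (complex.Im (f x))%:E).

Definition cintegral d (T : measurableType d) (R : realType)
    (mu : {measure set T -> \bar R}) (f : T -> R[i]) : R[i] :=
  (\int[mu]_x complex.Re (f x)) +i* (\int[mu]_x complex.Im (f x)).

Definition mx_measurable d (T : measurableType d) (R : realType) (q : nat)
    (F : T -> 'M[R[i]]_q) : Prop :=
  forall i j, measurable_fun setT (fun x => complex.Re (F x i j)) /\
              measurable_fun setT (fun x => complex.Im (F x i j)).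

Definition mx_integrable d (T : measurableType d) (R : realType)
    (mu : {measure set T -> \bar R}) (q : nat) (F : T -> 'M[R[i]]_q) : Prop :=
  forall i j, cintegrable mu (fun x => F x i j).

Definition mx_integral d (T : measurableType d) (R : realType)
    (mu : {measure set T -> \bar R}) (q : nat) (F : T -> 'M[R[i]]_q) :
    'M[R[i]]_q :=
  \matrix_(i, j) cintegral mu (fun x => F x i j).

Definition invw (T : Type) (R : realType) (q : nat) (W : T -> 'M[R[i]]_q) :
    T -> 'M[R[i]]_q :=
  fun x => invmx (W x).

Definition weight d (T : measurableType d) (R : realType)
    (mu : {measure set T -> \bar R}) (q : nat) (W : T -> 'M[R[i]]_q) : Prop :=
  mx_integrable mu W /\ forall x, posdefmx (W x).

Definition inv_weight d (T : measurableType d) (R : realType)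
    (mu : {measure set T -> \bar R}) (q : nat) (W : T -> 'M[R[i]]_q) : Prop :=
  weight mu W /\ mx_integrable mu (invw W).

(* Elements are functions rather than their almost-everywhere classes, so the
   "norm" is a seminorm whose kernel consists of the functions that vanish
   almost everywhere. *)
Definition L2 d (T : measurableType d) (R : realType)
    (mu : {measure set T -> \bar R}) (q : nat) (W : T -> 'M[R[i]]_q) :
    set (T -> 'M[R[i]]_q) :=
  [set F | mx_measurable F /\
           cintegrable mu (fun x => ntr (F x *m W x *m (F x) ^t*))].

Definition inner d (T : measurableType d) (R : realType)
    (mu : {measure set T -> \bar R}) (q : nat) (W : T -> 'M[R[i]]_q)
    (F G : T -> 'M[R[i]]_q) : 'M[R[i]]_q :=
  mx_integral mu (fun x => F x *m W x *m (G x) ^t*).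

Definition L2norm d (T : measurableType d) (R : realType)
    (mu : {measure set T -> \bar R}) (q : nat) (W : T -> 'M[R[i]]_q)
    (F : T -> 'M[R[i]]_q) : R :=
  Num.sqrt (complex.Re (ntr (inner mu W F F))).

Definition L2closure d (T : measurableType d) (R : realType)
    (mu : {measure set T -> \bar R}) (q : nat) (W : T -> 'M[R[i]]_q)
    (M : set (T -> 'M[R[i]]_q)) : set (T -> 'M[R[i]]_q) :=
  [set F | L2 mu W F /\
     forall e : R, 0 < e -> exists2 H, M H & L2norm mu W (F - H) < e].

(* For a closed submodule M of L^2(W) the element chosen exists and is unique up
   to almost everywhere equality; the default 0 of [xget] is never taken. *)
Definition orthoproj d (T : measurableType d) (R : realType)
    (mu : {measure set T -> \bar R}) (q : nat) (W : T -> 'M[R[i]]_q)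
    (M : set (T -> 'M[R[i]]_q)) (F : T -> 'M[R[i]]_q) : T -> 'M[R[i]]_q :=
  xget (cst 0) [set H | M H /\ forall K, M K -> inner mu W (F - H) K = 0].

Definition dual_module d (T : measurableType d) (R : realType)
    (mu : {measure set T -> \bar R}) (q : nat) (W : T -> 'M[R[i]]_q)
    (M : set (T -> 'M[R[i]]_q)) : set (T -> 'M[R[i]]_q) :=
  [set H | L2 mu (invw W) H /\
     forall F, M F -> mx_integral mu (fun x => F x *m (H x) ^t*) = 0].

(* The character of the dual group defined by g is evaluation [x |-> x g]. *)
Definition trigpoly (R : realType) (G : zmodType) (q : nat) (S : set G) :
    set (borel_dual R G -> 'M[R[i]]_q) :=
  [set F | exists (s : seq G) (A : G -> 'M[R[i]]_q),
     [set` s] `<=` S /\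
     F = (fun x : dual R G => \sum_(g <- s) x g *: A g)].

Definition trigmodule (R : realType) (G : zmodType)
    (mu : probability (borel_dual R G) R) (q : nat)
    (W : borel_dual R G -> 'M[R[i]]_q) (S : set G) :
    set (borel_dual R G -> 'M[R[i]]_q) :=
  L2closure mu W (@trigpoly R G q S).

Definition P_ (R : realType) (G : zmodType)
    (mu : probability (borel_dual R G) R) (q : nat)
    (W : borel_dual R G -> 'M[R[i]]_q) (S : set G) :
    (borel_dual R G -> 'M[R[i]]_q) -> (borel_dual R G -> 'M[R[i]]_q) :=
  orthoproj mu W (trigmodule mu W S).

Definition I_tilde (R : realType) (G : zmodType)
    (mu : probability (borel_dual R G) R) (q : nat)
    (W : borel_dual R G -> 'M[R[i]]_q) (S : set G) :
    borel_dual R G -> 'M[R[i]]_q :=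
  orthoproj mu (invw W)
    (dual_module mu W (trigmodule mu W (S `|` [set 0]))) (cst 1%:M).

(* Main.v *)
Require Import Defs.
From HB Require Import structures.
From mathcomp Require Import all_boot all_order all_algebra complex.
From mathcomp Require Import all_classical all_reals all_analysis.
From mathcomp Require Import measurable_realfun ring lra.

Set Implicit Arguments.
Unset Strict Implicit.
Unset Printing Implicit Defensive.

Import Order.TTheory GRing.Theory Num.Theory.
Import numFieldNormedType.Exports.

Local Open Scope classical_set_scope.
Local Open Scope ring_scope.
Local Open Scope complex_scope.

(** Write (F, G) for the inner product of L^2(W). Multiplication by W carries
    L^2(W) isometrically onto L^2(W^-1), maps W^-1 to I, and turns the pairing
    that defines the dual of a submodule into the inner product (F, H): the
    dual of M is the image H W of the orthogonal complement of M. Hence, if Q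
    is the projection of W^-1 onto M(S^0), then I - I~ is Q W and its norm is
    the norm of Q ([dual_residual]).

    The element W^-1 represents the integral: (F, W^-1) is the integral of F.
    A trigonometric polynomial A + K, with A constant and K in T(S), has
    integral A, because 0 is not in S and a nontrivial character has integral
    0. On M(S^0) the elements W^-1 and Q have the same inner products.
    Therefore F = A - P_S A satisfies tr (F, Q) = tr A = 1, and the
    Cauchy-Schwarz inequality gives 1 <= |F| |Q| ([residual_lower]).
    Conversely, let A + K be a polynomial close to Q. Then tr A = tr (A + K, Q)
    is close to |Q|^2, and |A - P_S A| <= |A + K| is close to |Q|; dividing by
    tr A gives competitors whose value tends to 1 / |Q| ([residual_upper]).

    Two facts support this argument. Projections exist because L^2(W) is
    complete ([L2_complete]): the entries satisfy
    |F_ij|^2 <= (F W F^* )_ii (W^-1)_jj, so L^2(W) is contained in L^1 when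
    W^-1 is integrable, a sequence with geometrically small increments
    converges almost everywhere, and Fatou's lemma gives convergence in norm.
    Nontrivial characters have integral 0 ([cintegral_char]) by invariance of
    the Haar measure, since for every g <> 0 some character of G is not 1 at g
    ([character_separation], by Zorn's lemma). *)

Local Notation Re := complex.Re.
Local Notation Im := complex.Im.

(** * Characters of a discrete abelian group separate its points *)

Section character_separation.
Context (R : realType) (G : zmodType).
Implicit Types (Gam : set (G * R[i])) (a b h : G) (z w : R[i]).

(** A character of a subgroup of G, encoded by its graph: a subgroup of G
    times the unit circle on which the first projection is injective.
    Extension of characters is then inclusion of graphs, as Zorn's lemma
    wants it. *)
Record partial_character Gam : Prop := PartialCharacter {
  pchar0 : Gam (0, 1);
  pcharB : forall a b z w, Gam (a, z) -> Gam (b, w) -> Gam (a - b, z / w);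
  pchar_fun : forall z, Gam (0, z) -> z = 1;
  pchar_norm : forall a z, Gam (a, z) -> `|z| = 1 }.

Lemma norm1_neq0 z : `|z| = 1 -> z != 0.
Proof. by move=> z1; rewrite -normr_eq0 z1 oner_eq0. Qed.

Lemma pcharN Gam a z : partial_character Gam -> Gam (a, z) -> Gam (- a, z^-1).
Proof. by move=> H Ga; have := pcharB H (pchar0 H) Ga; rewrite sub0r div1r. Qed.

Lemma pcharD Gam a b z w : partial_character Gam ->
  Gam (a, z) -> Gam (b, w) -> Gam (a + b, z * w).
Proof.
by move=> H Ga /(pcharN H) Gb; have := pcharB H Ga Gb; rewrite opprK invrK.
Qed.

Lemma pcharXn Gam a z n : partial_character Gam ->
  Gam (a, z) -> Gam (a *+ n, z ^+ n).
Proof.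
move=> H Ga; elim: n => [|n IH]; first by rewrite mulr0n expr0; exact: (pchar0 H).
by rewrite mulrS exprS; exact: pcharD.
Qed.

Lemma pcharXz Gam a z (k : int) : partial_character Gam ->
  Gam (a, z) -> Gam (a *~ k, z ^ k).
Proof.
move=> H Ga; case: k => n; first exact: pcharXn.
by rewrite NegzE mulrNz -exprnN; apply: (pcharN H); exact: pcharXn.
Qed.

Lemma pchar_inj Gam a z w : partial_character Gam ->
  Gam (a, z) -> Gam (a, w) -> z = w.
Proof.
move=> H Gz Gw; have /(pchar_fun H) : Gam (0, z / w).
  by rewrite -(subrr a); exact: (pcharB H).
by move/divr1_eq.
Qed.

(** If z is not 1, no n-th root of z is 1. If z is 1, a root of 1 + X + ...
    + X^(n-1) is an n-th root of 1, and it is not 1 because this polynomial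
    takes the value n at 1. *)
Lemma unimodular_root_neq1 n z : (1 < n)%N -> `|z| = 1 ->
  exists w, [/\ w ^+ n = z, w != 1 & `|w| = 1].
Proof.
move=> n1 z1; have n0 : (0 < n)%N by exact: ltnW.
suff [w wz w1] : exists2 w, w ^+ n = z & w != 1.
  exists w; split => //; apply/eqP; rewrite -(pexpr_eq1 n0)// -normrX wz.
  exact/eqP.
have [->|zn1] := eqVneq z 1; last first.
  exists (n.-root z); first by rewrite rootCK.
  by apply: contra_neq zn1 => w1; rewrite -(rootCK n0 z) w1 expr1n.
have : size (\poly_(i < n) (1 : R[i])) != 1%N.
  by rewrite size_poly_eq ?oner_eq0// gtn_eqF.
case/closed_rootP => w; rewrite rootE horner_poly => /eqP.
under eq_bigr do rewrite mul1r.
move=> w0.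
exists w.
  by apply/eqP; rewrite -subr_eq0 subrX1 w0 mulr0.
apply/eqP => w1; move: w0; rewrite w1.
under eq_bigr do rewrite expr1n.
by rewrite sumr_const card_ord; apply/eqP; rewrite pnatr_eq0 -lt0n.
Qed.

(** The subgroup generated by Gam and the pair (h, w). *)
Definition pchar_adjoin Gam h w : set (G * R[i]) :=
  [set p | exists a z (k : int), Gam (a, z) /\ p = (a + h *~ k, z * w ^ k)].

Lemma sub_pchar_adjoin Gam h w : Gam `<=` pchar_adjoin Gam h w.
Proof.
by move=> [a z] Ga; exists a, z, 0; rewrite mulr0z addr0 expr0z mulr1.
Qed.

Lemma pchar_adjoin_in Gam h w : partial_character Gam ->
  pchar_adjoin Gam h w (h, w).
Proof.
by move=> H; exists 0, 1, 1; split; [exact: (pchar0 H)|rewrite add0r mul1r].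
Qed.

Lemma norm1X w (k : int) : `|w| = 1 -> `|w ^ k| = 1.
Proof.
move=> w1; case: k => n; first by rewrite -exprnP normrX w1 expr1n.
by rewrite NegzE -exprnN normfV normrX w1 expr1n invr1.
Qed.

(** The first projection stays injective as soon as w is compatible with the
    values already prescribed on the multiples of h. *)
Lemma pchar_adjoinP Gam h w : partial_character Gam -> `|w| = 1 ->
  (forall k z, Gam (h *~ k, z) -> z = w ^ k) ->
  partial_character (pchar_adjoin Gam h w).
Proof.
move=> H w1 hw; have w0 := norm1_neq0 w1; split.
- exact: sub_pchar_adjoin (pchar0 H).
- move=> a b z z' [a1 [z1 [k1 [G1 [-> ->]]]]] [a2 [z2 [k2 [G2 [-> ->]]]]].
  exists (a1 - a2), (z1 / z2), (k1 - k2); split; first exact: (pcharB H).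
  congr (_, _); first by rewrite mulrzBr opprD addrACA.
  by rewrite expfzDr// invfM mulrACA invr_expz.
- move=> z [a [z1 [k [Ga [/esym/eqP + ->]]]]].
  rewrite addr_eq0 => /eqP aE.
  have := pcharN H Ga; rewrite aE opprK => /hw <-.
  by rewrite mulfV// (norm1_neq0 (pchar_norm H Ga)).
- move=> a z [a1 [z1 [k [Ga [_ ->]]]]].
  by rewrite normrM (pchar_norm H Ga) norm1X// mulr1.
Qed.

(** If some positive multiple of h lies in the domain, let n h be the least
    one and v its value: the multiples of h in the domain are those of n h,
    so any n-th root w of v is compatible; n is at least 2 because h is
    outside the domain, which leaves room for w <> 1. If there is no such
    multiple, every w of modulus 1 is compatible. The clause w <> 1 is what
    makes characters separate points when h is adjoined to the trivial
    group. *)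
Lemma pchar_extend Gam h : partial_character Gam ->
  (forall z, ~ Gam (h, z)) ->
  exists2 w, w != 1 & partial_character (pchar_adjoin Gam h w).
Proof.
move=> H hdom; pose dom (n : nat) := `[< exists z, Gam (h *+ n, z) >].
have domz (k : int) z : Gam (h *~ k, z) -> dom `|k|%N.
  move=> Gk; apply/asboolP; case: k Gk => n; first by exists z.
  by rewrite NegzE mulrNz => /(pcharN H); rewrite opprK; exists z^-1.
pose p n := (0 < n)%N && dom n.
have [pex|nodom] := pselect (exists n, p n); last first.
  exists (-1).
    by rewrite -subr_eq0 -opprD oppr_eq0 -(natrD _ 1 1) pnatr_eq0.
  apply: pchar_adjoinP => //; first by rewrite normrN1.
  move=> k z Gk; have := domz _ _ Gk; case: (posnP `|k|%N) => [/eqP|k0 dk].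
    rewrite absz_eq0 => /eqP k0 _; move: Gk; rewrite k0 mulr0z => /(pchar_fun H).
    by rewrite expr0z.
  by exfalso; apply: nodom; exists `|k|%N; rewrite /p k0.
have [n /andP[n_gt0 /asboolP[v Gv]] nmin] := ex_minnP pex.
have n_gt1 : (1 < n)%N.
  rewrite ltn_neqAle n_gt0 andbT; apply/eqP => n1.
  by apply: (hdom v); move: Gv; rewrite -n1.
have [w [wv wn1 w1]] := unimodular_root_neq1 n_gt1 (pchar_norm H Gv).
exists w => //; apply: pchar_adjoinP => // k z Gk.
pose m := (k %/ n)%Z; pose r := (k %% n)%Z.
have kE : k = m * n + r by exact: divz_eq.
have Gm : Gam (h *~ (m * n), v ^ m).
  by rewrite mulrC mulrzA; exact: pcharXz.
have r0 : r = 0.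
  have r_ge0 : 0 <= r by rewrite modz_ge0// eqz_nat -lt0n.
  have r_lt : r < n by rewrite ltz_pmod.
  have Gr : Gam (h *~ r, z / v ^ m).
    have -> : r = k - m * n by rewrite kE addrC addKr.
    by rewrite mulrzBr; exact: (pcharB H).
  apply/eqP; apply: contraT => rn0.
  have := nmin `|r|%N; rewrite /p absz_gt0 rn0 (domz _ _ Gr) => /(_ isT).
  by rewrite leqNgt -ltz_nat gez0_abs// r_lt.
move: Gk; rewrite kE r0 addr0 => Gk.
by rewrite (pchar_inj H Gk Gm) -wv mulrC -exprz_exp.
Qed.

Lemma pchar1 : partial_character [set (0, 1)].
Proof.
split => //.
- by move=> a b z w [-> ->] [-> ->]; rewrite /= subr0 divr1.
- by move=> z [].
- by move=> a z [_ ->]; rewrite normr1.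
Qed.

Lemma pchar_maximal Gam : partial_character Gam -> exists Gam',
  [/\ partial_character Gam', Gam `<=` Gam' & forall h, exists z, Gam' (h, z)].
Proof.
(* The empty set is admitted since it is the union of the empty chain. *)
move=> H; pose P Gam' := Gam' = set0 \/ partial_character Gam' /\ Gam `<=` Gam'.
have [|M [PM Mmax]] := @Zorn_bigcup _ P.
  move=> F FP tot; have [[X FX X0]|F0] :=
    pselect (exists2 X, F X & X !=set0); last first.
    left; apply/seteqP; split => // x [X FX Xx]; apply: F0.
    by exists X => //; exists x.
  have PF Y : F Y -> Y !=set0 -> partial_character Y /\ Gam `<=` Y.
    by case/FP => [-> /set0P/eqP|? _].
  have [HX sX] := PF _ FX X0.
  right; split; last by move=> x /sX Xx; exists X.
  split.
  - by exists X => //; exact: (pchar0 HX).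
  - move=> a b z w [Y FY Ya] [Z FZ Zb].
    have [HY _] : partial_character Y /\ Gam `<=` Y by apply: PF => //; exists (a, z).
    have [HZ _] : partial_character Z /\ Gam `<=` Z by apply: PF => //; exists (b, w).
    have [YZ|ZY] := tot _ _ FY FZ.
      by exists Z => //; apply: (pcharB HZ) => //; exact: YZ.
    by exists Y => //; apply: (pcharB HY) => //; exact: ZY.
  - move=> z [Y FY Yz]; have [|HY _] := PF _ FY; first by exists (0, z).
    exact: (pchar_fun HY).
  - move=> a z [Y FY Yz]; have [|HY _] := PF _ FY; first by exists (a, z).
    exact: (pchar_norm HY Yz).
case: PM => [M0|[HM sM]].
  exfalso; apply: (Mmax Gam); last by right; split.
  by rewrite M0; split => // /(_ _ (pchar0 H)).
exists M; split => // h; apply: contrapT => hdom.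
have [w w1 HM'] := pchar_extend HM (fun z Mz => hdom (ex_intro _ z Mz)).
apply: (Mmax (pchar_adjoin M h w)); last first.
  by right; split => //; apply: subset_trans sM _; exact: sub_pchar_adjoin.
split; first exact: sub_pchar_adjoin.
move=> /(_ _ (pchar_adjoin_in h w HM)) Mh; apply: hdom; by exists w.
Qed.

(** Adjoin g to the trivial group with a value other than 1, and extend the
    result to all of G. *)
Lemma character_separation (g : G) : g != 0 -> exists x : dual R G, x g != 1.
Proof.
move=> g0; have [|w w1 Hw] := @pchar_extend _ g pchar1.
  by move=> z [/eqP]; rewrite (negbTE g0).
have [M [HM sM /choice[x Mx]]] := pchar_maximal Hw.
have xN h : `|x h| = 1 by exact: (pchar_norm HM (Mx h)).
have xD a b : x (a + b) = x a * x b.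
  by apply: (pchar_inj HM (Mx _)); exact: pcharD.
exists (Character xN xD) => /=; suff -> : x g = w by [].
by apply: (pchar_inj HM (Mx g)); apply: sM; exact: pchar_adjoin_in pchar1.
Qed.

End character_separation.

(** * Orthogonal projection for a semi-inner product *)

Section real_inequalities.
Context (R : realType).

Lemma eq0_of_quad_le (a b : R) : 0 <= b -> (forall t, 2 * t * a <= t ^+ 2 * b) -> a = 0.
Proof.
(* The minimum is at a / b, but b may be 0. *)
move=> b0 /(_ (a / (b + 1))) h; have b1 : 0 < b + 1 by rewrite ltr_wpDl.
have : 2 * a ^+ 2 * (b + 1) <= a ^+ 2 * b.
  rewrite -(ler_pM2r (exprn_gt0 2 (_ : 0 < (b + 1)^-1))) ?invr_gt0//.
  apply: le_trans (le_trans h _); rewrite le_eqVlt; apply/orP; left; apply/eqP;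
  by field; rewrite gt_eqF.
move=> h2; apply/eqP; rewrite -sqrf_eq0 eq_le sqr_ge0 andbT.
by have := sqr_ge0 a; move: h2; set c := a ^+ 2; nra.
Qed.

Lemma quad_le_mul (x y a : R) : 0 <= x -> 0 <= y ->
  (forall t, 2 * t * a <= x ^+ 2 + t ^+ 2 * y ^+ 2) -> a <= x * y.
Proof.
move=> x0 y0 h; rewrite leNgt; apply/negP => xya.
have a0 : 0 < a by apply: le_lt_trans xya; exact: mulr_ge0.
have [y00|y1] := eqVneq y 0.
  have := h ((x ^+ 2 + 1) / (2 * a)); rewrite y00.
  have -> : 2 * ((x ^+ 2 + 1) / (2 * a)) * a = x ^+ 2 + 1 by field; rewrite gt_eqF.
  by rewrite expr0n/= mulr0 addr0 gerDl ler10.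
have := h (a / y ^+ 2).
have -> : (a / y ^+ 2) ^+ 2 * y ^+ 2 = a ^+ 2 / y ^+ 2 by field.
have -> : 2 * (a / y ^+ 2) * a = 2 * (a ^+ 2 / y ^+ 2) by field.
move=> h1; have : a ^+ 2 / y ^+ 2 <= x ^+ 2 by lra.
rewrite ler_pdivrMr ?exprn_gt0 ?lt_def ?y1// -exprMn => h2.
by move: xya; rewrite ltNge -(@ler_pXn2r _ 2)// ?nnegrE ?mulr_ge0 ?(ltW a0)// h2.
Qed.

Lemma half_expn_small (e : R) : 0 < e -> exists n, 2^-1 ^+ n < e.
Proof.
move=> e0; have h : `|2^-1 : R| < 1.
  by rewrite ger0_norm ?invr_ge0// invf_lt1 ?ltr1n.
have /cvgrPdist_lt/(_ e e0) [n _ /(_ n (leqnn n))/=] := cvg_expr h.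
by rewrite sub0r normrN ger0_norm ?exprn_ge0// => ?; exists n.
Qed.

Lemma le_half_expn (a b c : R) : (forall n, a <= b + c * 2^-1 ^+ n) -> a <= b.
Proof.
move=> h; apply/ler_addgt0Pl => e e0; have c0 : 0 < `|c| + 1 by rewrite ltr_wpDl.
have [n nlt] := half_expn_small (divr_gt0 e0 c0).
rewrite (le_trans (h n))// addrC lerD2r.
have p0 : 0 <= 2^-1 ^+ n :> R by rewrite exprn_ge0.
move: nlt; rewrite ltr_pdivlMr// => nlt; have := ler_norm c; nra.
Qed.

Lemma sum_half_expn (n : nat) : \sum_(0 <= k < n) (2^-1 ^+ k : R) <= 2.
Proof.
have -> : \sum_(0 <= k < n) (2^-1 ^+ k : R) = 2 - 2 * 2^-1 ^+ n.
  elim: n => [|n IH]; first by rewrite big_nil expr0; ring.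
  by rewrite big_nat_recr//= IH exprS; field.
by rewrite gerBl mulr_ge0// exprn_ge0.
Qed.

End real_inequalities.

Section semi_hilbert.
Context (R : realType) (V : lmodType R[i]) (D : set V) (ip : V -> V -> R).

(** The form is constrained on the domain D only: it is meant for integrals,
    which have the expected algebra on integrable functions. Only real
    scalars occur, although V is a complex space. *)
Record semi_inner_product : Prop := SemiInnerProduct {
  dom0 : D 0;
  domD : forall u v, D u -> D v -> D (u + v);
  domZ : forall (t : R) u, D u -> D (t%:C *: u);
  ipDl : forall u v w, D u -> D v -> D w -> ip (u + v) w = ip u w + ip v w;
  ipZl : forall (t : R) u w, D u -> D w -> ip (t%:C *: u) w = t * ip u w;
  ipC : forall u v, D u -> D v -> ip u v = ip v u;
  ip_ge0 : forall u, D u -> 0 <= ip u u }.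

Hypothesis H : semi_inner_product.

Definition seminorm (u : V) : R := Num.sqrt (ip u u).

Let oppZ (u : V) : - u = (-1 : R)%:C *: u.
Proof. by rewrite rmorphN1 scaleN1r. Qed.

Lemma domN u : D u -> D (- u).
Proof. by move=> Du; rewrite oppZ; exact: (domZ H). Qed.

Lemma domB u v : D u -> D v -> D (u - v).
Proof. by move=> Du /domN; exact: domD. Qed.

Lemma ipNl u w : D u -> D w -> ip (- u) w = - ip u w.
Proof.
by move=> Du Dw; rewrite oppZ (ipZl H)// mulN1r.
Qed.

Lemma ipBl u v w : D u -> D v -> D w -> ip (u - v) w = ip u w - ip v w.
Proof. by move=> Du Dv Dw; rewrite (ipDl H)//; [rewrite ipNl|exact: domN]. Qed.

Lemma ipDr u v w : D u -> D v -> D w -> ip w (u + v) = ip w u + ip w v.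
Proof.
move=> Du Dv Dw; rewrite (ipC H)//; last exact: (domD H).
by rewrite (ipDl H)// (ipC H Dw Du) (ipC H Dw Dv).
Qed.

Lemma ipBr u v w : D u -> D v -> D w -> ip w (u - v) = ip w u - ip w v.
Proof.
move=> Du Dv Dw; rewrite (ipC H)//; last exact: domB.
by rewrite ipBl// (ipC H Dw Du) (ipC H Dw Dv).
Qed.

Lemma ipZr t u w : D u -> D w -> ip w (t%:C *: u) = t * ip w u.
Proof.
move=> Du Dw; rewrite (ipC H)//; last exact: (domZ H).
by rewrite (ipZl H)// (ipC H Dw Du).
Qed.

Lemma seminorm_ge0 u : 0 <= seminorm u.
Proof. exact: sqrtr_ge0. Qed.

Lemma sqr_seminorm u : D u -> seminorm u ^+ 2 = ip u u.
Proof. by move=> Du; rewrite sqr_sqrtr// (ip_ge0 H). Qed.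

Lemma seminormN u : D u -> seminorm (- u) = seminorm u.
Proof.
move=> Du; rewrite /seminorm ipNl//; last exact: domN.
by rewrite (ipC H) ?ipNl ?opprK//; exact: domN.
Qed.

Lemma seminormBC u v : D u -> D v -> seminorm (u - v) = seminorm (v - u).
Proof. by move=> Du Dv; rewrite -opprB seminormN//; exact: domB. Qed.

Lemma cauchy_schwarz u v : D u -> D v -> ip u v <= seminorm u * seminorm v.
Proof.
move=> Du Dv; apply: quad_le_mul; [exact: seminorm_ge0|exact: seminorm_ge0|move=> t].
have Dt := domZ H t Dv; have Db := domB Du Dt; have := ip_ge0 H Db.
by rewrite ipBl// !ipBr// !ipZr// !(ipZl H)// (ipC H Dv Du) -!sqr_seminorm// expr2; lra.
Qed.

Lemma seminormD u v : D u -> D v -> seminorm (u + v) <= seminorm u + seminorm v.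
Proof.
move=> Du Dv; have Duv := domD H Du Dv.
rewrite -(@ler_pXn2r _ 2)// ?nnegrE ?addr_ge0 ?seminorm_ge0//.
rewrite sqr_seminorm// (ipDl H)// !ipDr// (ipC H Dv Du) sqrrD -!sqr_seminorm//.
by have := cauchy_schwarz Du Dv; lra.
Qed.

Lemma parallelogram u v : D u -> D v ->
  ip (u + v) (u + v) + ip (u - v) (u - v) = 2 * ip u u + 2 * ip v v.
Proof.
move=> Du Dv; have Da := domD H Du Dv; have Db := domB Du Dv.
rewrite ipBl// !ipBr// (ipDl H Du Dv Da) !ipDr// (ipC H Dv Du); ring.
Qed.

Variable N : set V.
Hypothesis N_sub : N `<=` D.
Hypothesis N0 : N 0.
Hypothesis ND : forall u v, N u -> N v -> N (u + v).
Hypothesis NZ : forall (t : R) u, N u -> N (t%:C *: u).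

Hypothesis complete : forall u : nat -> V, (forall n, N (u n)) ->
  (forall n, seminorm (u n.+1 - u n) <= 2^-1 ^+ n) ->
  exists2 l, D l & forall n, seminorm (l - u n) <= 2 * 2^-1 ^+ n.

(** A minimizing sequence in N is chosen so fast that the parallelogram
    identity bounds its increments by 2^-n; thus completeness is only asked
    for such sequences. The projection is a limit of elements of N that lies
    in D, and not necessarily in N. *)
Lemma projection f : D f -> exists l, [/\ D l,
  forall e, 0 < e -> exists2 k, N k & seminorm (l - k) < e &
  forall k, N k -> ip (f - l) k = 0].
Proof.
move=> Df; pose A := [set ip (f - k) (f - k) | k in N]; pose m := inf A.
have hA : has_inf A.
  split; first by exists (ip (f - 0) (f - 0)); exists 0.
  by exists 0 => _ [k Nk <-]; apply: (ip_ge0 H); apply: domB => //; exact: N_sub.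
have mle k : N k -> m <= ip (f - k) (f - k).
  by move=> Nk; apply: ge_inf; [exact: hA.2|exists k].
have m0 : 0 <= m.
  apply: lb_le_inf; first exact: hA.1.
  by move=> _ [k Nk <-]; apply: (ip_ge0 H); apply: domB => //; exact: N_sub.
have p0 n : 0 < 2^-1 ^+ n :> R by rewrite exprn_gt0// invr_gt0.
(* The excess 4^-n / 4 over the infimum m of the squared distances makes the
   squared increments at most 4^-n. *)
have /choice[u hu] n : exists k, N k /\ ip (f - k) (f - k) < m + (2^-1 ^+ n) ^+ 2 / 4.
  have e0 : 0 < (2^-1 ^+ n) ^+ 2 / 4 :> R by rewrite divr_gt0// exprn_gt0.
  by have [_ [k Nk <-] lt] := inf_adherent e0 hA; exists k.
have Nu n : N (u n) by case: (hu n).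
have Du n : D (u n) by exact: N_sub.
have Dfu n : D (f - u n) by exact: domB.
have [|l Dl hl] := complete Nu.
  move=> n; rewrite -(@ler_pXn2r _ 2)// ?nnegrE ?seminorm_ge0 ?(ltW (p0 _))//.
  rewrite sqr_seminorm; last exact: domB.
  have := parallelogram (Dfu n) (Dfu n.+1).
  rewrite (_ : f - u n - (f - u n.+1) = u n.+1 - u n); last first.
    by rewrite opprB addrC addrA subrK.
  pose v := (2^-1 : R)%:C *: (u n + u n.+1).
  have Nv : N v by apply: NZ; exact: ND.
  have -> : f - u n + (f - u n.+1) = (2 : R)%:C *: (f - v).
    rewrite scalerBr scalerA -rmorphM/= divff// scale1r opprD addrACA.
    by rewrite -[(2 : R)%:C]/(2%:R%:C) rmorph_nat scaler_nat mulr2n.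
  have Dv : D (f - v) by apply: domB => //; exact: N_sub.
  rewrite ipZr// ?(ipZl H)//; last exact: (domZ H).
  have := mle _ Nv; have := (hu n).2; have := (hu n.+1).2.
  rewrite [2^-1 ^+ n.+1]exprS exprMn.
  have : 0 <= (2^-1 ^+ n) ^+ 2 :> R by exact: sqr_ge0.
  set w := (2^-1 ^+ n) ^+ 2; set a := ip _ _; set b := ip _ _; set c := ip _ _.
  by set e := ip _ _; lra.
have sq n : seminorm (f - u n) <= Num.sqrt m + 2^-1 ^+ n.
  rewrite -(@ler_pXn2r _ 2)//
    ?nnegrE ?seminorm_ge0 ?addr_ge0 ?sqrtr_ge0 ?(ltW (p0 _))//.
  rewrite sqr_seminorm// sqrrD sqr_sqrtr//.
  have := (hu n).2; have := sqr_ge0 (2^-1 ^+ n : R).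
  have : 0 <= Num.sqrt m * 2^-1 ^+ n by rewrite mulr_ge0// ?sqrtr_ge0 ?(ltW (p0 _)).
  set w := (2^-1 ^+ n) ^+ 2; set a := ip _ _; set b := _ * _; rewrite mulr2n; lra.
exists l; split => //.
  move=> e e0; have [n nlt] := half_expn_small (divr_gt0 e0 (ltr0n _ 2)).
  exists (u n) => //; apply: le_lt_trans (hl n) _.
  by move: nlt; rewrite ltr_pdivlMr// mulrC.
move=> k Nk; have Dk := N_sub Nk; have Dfl := domB Df Dl.
apply: (eq0_of_quad_le (ip_ge0 H Dk)) => t; have Dtk := domZ H t Dk.
(* The limit l still minimizes the distance to f along the line through l
   directed by k; comparing the squares of the two distances gives the
   quadratic inequality in t. *)
suff : seminorm (f - l) <= seminorm (f - l - t%:C *: k).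
  rewrite -(@ler_pXn2r _ 2)// ?nnegrE ?seminorm_ge0// !sqr_seminorm//; last exact: domB.
  have Dg := domB Dfl Dtk; rewrite (ipBl Dfl Dtk Dg) !(ipBr Dfl Dtk)//.
  by rewrite !ipZr// !(ipZl H)// (ipC H Dk Dfl) expr2; lra.
apply: (@le_half_expn R _ _ 5) => n.
have h1 : seminorm (f - l) <= seminorm (f - u n) + 2 * 2^-1 ^+ n.
  rewrite (_ : f - l = (f - u n) + (u n - l)); last by rewrite addrA subrK.
  apply: le_trans (seminormD (Dfu n) (domB (Du n) Dl)) _.
  by rewrite lerD2l seminormBC//.
have h2 : Num.sqrt m <= seminorm (f - l - t%:C *: k) + 2 * 2^-1 ^+ n.
  have NK : N (u n + t%:C *: k) by apply: ND => //; exact: NZ.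
  apply: (@le_trans _ _ (seminorm (f - (u n + t%:C *: k)))).
    by rewrite ler_wsqrtr// mle.
  rewrite (_ : f - _ = (f - l - t%:C *: k) + (l - u n)).
    by apply: le_trans (seminormD (domB Dfl Dtk) (domB Dl (Du n))) _; rewrite lerD2l.
  by rewrite [RHS]addrAC [f - l + _]addrA subrK opprD addrA.
have := sq n; move: h1 h2; set a := seminorm (f - l); set b := seminorm (_ - _).
by set c := seminorm _; set s := Num.sqrt m; set w := _ ^+ n; lra.
Qed.

Definition close_to (u : V) :=
  forall e : R, 0 < e -> exists2 k, N k & seminorm (u - k) < e.

(** By Cauchy-Schwarz the form is continuous in its second argument. *)
Lemma ip_closure u v : D u -> D v -> close_to v ->
  (forall k, N k -> ip u k = 0) -> ip u v = 0.
Proof.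
move=> Du Dv cv h.
suff abs w : D w -> (forall k, N k -> ip w k = 0) -> ip w v <= 0.
  apply/eqP; rewrite eq_le abs//= -oppr_le0 -ipNl//; apply: abs.
    exact: domN.
  by move=> k Nk; rewrite ipNl ?h ?oppr0//; exact: N_sub.
move=> Dw hw; apply/ler_addgt0Pl => e e0; rewrite addr0.
have s0 : 0 < seminorm w + 1 by rewrite ltr_wpDl ?seminorm_ge0.
have [k Nk klt] := cv _ (divr_gt0 e0 s0).
have Dk := N_sub Nk; have -> : ip w v = ip w (v - k) by rewrite ipBr// (hw _ Nk) subr0.
apply: le_trans (cauchy_schwarz Dw (domB Dv Dk)) _.
move: klt; rewrite ltr_pdivlMr//; have := seminorm_ge0 w.
have := seminorm_ge0 (v - k); set a := seminorm _; set b := seminorm _; nra.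
Qed.

End semi_hilbert.

(** The square of the norm of f - h is the product of f - h with f - k, so
    Cauchy-Schwarz applies. This gives the minimality of projections;
    applied in both directions it also shows that two projections of f on
    the same subspace leave residuals of the same norm. *)
Lemma residual_min (R : realType) (V : lmodType R[i]) (D : set V)
    (ip : V -> V -> R) (H : semi_inner_product D ip) (f h k : V) :
  D f -> D h -> D k -> ip (f - h) h = 0 -> ip (f - h) k = 0 ->
  seminorm ip (f - h) <= seminorm ip (f - k).
Proof.
move=> Df Dh Dk hh hk; have Dfh := domB H Df Dh; have Dfk := domB H Df Dk.
have [->|n0] := eqVneq (seminorm ip (f - h)) 0; first exact: seminorm_ge0.
have : 0 < seminorm ip (f - h) by rewrite lt_def n0 seminorm_ge0.
move=> /ler_pM2l <-; rewrite -expr2 (sqr_seminorm H Dfh).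
have -> : ip (f - h) (f - h) = ip (f - h) (f - k).
  by rewrite (ipBr H Df Dh Dfh) (ipBr H Df Dk Dfh) hh hk.
exact: (cauchy_schwarz H).
Qed.

Lemma seminorm_telescope (R : realType) (V : lmodType R[i]) (D : set V) (ip : V -> V -> R)
    (H : semi_inner_product D ip) (u : nat -> V) :
  (forall n, D (u n)) ->
  (forall n, seminorm ip (u n.+1 - u n) <= 2^-1 ^+ n) ->
  forall n m, seminorm ip (u (n + m)%N - u n) <= 2 * 2^-1 ^+ n.
Proof.
move=> Du hu n m.
suff : seminorm ip (u (n + m)%N - u n) <= 2 * 2^-1 ^+ n - 2 * 2^-1 ^+ (n + m).
  by move/le_trans; apply; rewrite gerBl mulr_ge0// exprn_ge0.
elim: m => [|m IH].
  by rewrite addn0 !subrr /seminorm -(scaler0 _ (0 : R)%:C) (ipZl H) ?mul0r ?sqrtr0//;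
    [exact: (dom0 H)|rewrite scaler0; exact: (dom0 H)].
rewrite addnS (_ : _ - _ = (u (n + m).+1 - u (n + m)%N) + (u (n + m)%N - u n)).
  apply: le_trans (seminormD H (domB H (Du _) (Du _)) (domB H (Du _) (Du _))) _.
  have := hu (n + m)%N; rewrite exprS; move: IH.
  by set a := seminorm _ _; set b := seminorm _ _; set w := 2^-1 ^+ (n + m); lra.
by rewrite addrA subrK.
Qed.

Local Open Scope sesquilinear_scope.

(** * Integrals of complex and matrix-valued functions *)

Lemma cReD (R : realType) (z w : R[i]) : Re (z + w) = Re z + Re w.
Proof. by case: z w => [a b] [c d]. Qed.

Lemma cImD (R : realType) (z w : R[i]) : Im (z + w) = Im z + Im w.
Proof. by case: z w => [a b] [c d]. Qed.

Lemma cReM (R : realType) (z w : R[i]) :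
  Re (z * w) = Re z * Re w - Im z * Im w.
Proof. by case: z w => [a b] [c d]. Qed.

Lemma cImM (R : realType) (z w : R[i]) :
  Im (z * w) = Re z * Im w + Im z * Re w.
Proof. by case: z w => [a b] [c d]. Qed.

Lemma cReJ (R : realType) (z : R[i]) : Re (Num.conj z) = Re z.
Proof. by case: z. Qed.

Lemma cImJ (R : realType) (z : R[i]) : Im (Num.conj z) = - Im z.
Proof. by case: z. Qed.

Lemma cRe_sum (R : realType) (I : Type) (s : seq I) (f : I -> R[i]) :
  Re (\sum_(k <- s) f k) = \sum_(k <- s) Re (f k).
Proof. exact: (big_morph _ (@cReD R) (erefl : Re (0 : R[i]) = 0)). Qed.

Lemma eq_complexP (R : realType) (z w : R[i]) :
  Re z = Re w -> Im z = Im w -> z = w.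
Proof. by case: z w => [a b] [c d] /= -> ->. Qed.

(** Rescaling by a^-1 divides a norm by the modulus of a, which is at least
    the real part of a. *)
Lemma mulr_Re_le (R : realType) (a : R[i]) (x y : R) : a != 0 -> 0 <= y ->
  x%:C = `|a^-1| * y%:C -> x * Re a <= y.
Proof.
move=> a0 y0 xE; have na : `|a| != 0 by rewrite normr_eq0.
have x0 : 0 <= x%:C by rewrite xE mulr_ge0// ler0c.
have -> : y = x * Re (`|a|).
  apply: (@complexI R); transitivity (x%:C * (Re `|a|)%:C); last by rewrite -rmorphM.
  rewrite xE; by rewrite (RRe_real (normr_real _)) normfV mulrAC mulVf// mul1r.
have x0' : 0 <= x by rewrite -ler0c.
apply: ler_wpM2l => //; rewrite -lecR (RRe_real (normr_real _)).
by apply: le_trans (normc_ge_Re _); rewrite lecR ler_norm.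
Qed.

Section measurable_complex.
Context d (T : measurableType d) (R : realType).
Implicit Types f g : T -> R[i].

Definition cmeasurable f :=
  measurable_fun setT (fun x => Re (f x)) /\
  measurable_fun setT (fun x => Im (f x)).

Lemma cmeasurable_cst (z : R[i]) : cmeasurable (fun=> z).
Proof. by split; exact: measurable_cst. Qed.

Lemma cmeasurableD f g : cmeasurable f -> cmeasurable g ->
  cmeasurable (fun x => f x + g x).
Proof.
move=> [f1 f2] [g1 g2]; split;
  [under eq_fun do rewrite cReD|under eq_fun do rewrite cImD];
  exact: measurable_funD.
Qed.

Lemma cmeasurableM f g : cmeasurable f -> cmeasurable g ->
  cmeasurable (fun x => f x * g x).
Proof.
move=> [f1 f2] [g1 g2]; split;
  [under eq_fun do rewrite cReM|under eq_fun do rewrite cImM].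
- by apply: measurable_funB; exact: measurable_funM.
- by apply: measurable_funD; exact: measurable_funM.
Qed.

Lemma cmeasurableJ f : cmeasurable f -> cmeasurable (fun x => Num.conj (f x)).
Proof.
move=> [f1 f2]; split;
  [under eq_fun do rewrite cReJ|under eq_fun do rewrite cImJ] => //.
exact: measurableT_comp.
Qed.

Lemma cmeasurable_sum (I : Type) (s : seq I) (f : I -> T -> R[i]) :
  (forall k, cmeasurable (f k)) -> cmeasurable (fun x => \sum_(k <- s) f k x).
Proof.
move=> mf; elim: s => [|k s IH].
  by under eq_fun do rewrite big_nil; exact: cmeasurable_cst.
by under eq_fun do rewrite big_cons; exact: cmeasurableD.
Qed.

Variable q : nat.
Implicit Types F G : T -> 'M[R[i]]_q.

Lemma mx_measurable_ext F (h : 'I_q -> 'I_q -> T -> R[i]) :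
  (forall i j x, F x i j = h i j x) ->
  (forall i j, cmeasurable (h i j)) -> mx_measurable F.
Proof.
move=> Fh mh i j; rewrite (_ : (fun x => Re _) = fun x => Re (h i j x)).
  rewrite (_ : (fun x => Im _) = fun x => Im (h i j x)); first exact: mh.
  by apply/funext => x; rewrite Fh.
by apply/funext => x; rewrite Fh.
Qed.

Lemma mx_measurable_cst (A : 'M[R[i]]_q) : mx_measurable (fun _ : T => A).
Proof. by move=> i j; exact: cmeasurable_cst. Qed.

Lemma mx_measurableD F G : mx_measurable F -> mx_measurable G ->
  mx_measurable (fun x => F x + G x).
Proof.
move=> mF mG.
apply: (@mx_measurable_ext _ (fun i j x => F x i j + G x i j)) => [i j x|i j].
  by rewrite mxE.
exact: cmeasurableD (mF i j) (mG i j).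
Qed.

Lemma mx_measurableM F G : mx_measurable F -> mx_measurable G ->
  mx_measurable (fun x => F x *m G x).
Proof.
move=> mF mG.
apply: (@mx_measurable_ext _ (fun i j x => \sum_k F x i k * G x k j)) => [i j x|i j].
  by rewrite mxE.
by apply: cmeasurable_sum => k; exact: cmeasurableM (mF i k) (mG k j).
Qed.

Lemma mx_measurable_adj F : mx_measurable F -> mx_measurable (fun x => (F x)^t*).
Proof.
move=> mF.
apply: (@mx_measurable_ext _ (fun i j x => Num.conj (F x j i))) => [i j x|i j].
  by rewrite !mxE.
exact: cmeasurableJ (mF j i).
Qed.

Lemma cmeasurable_tr F : mx_measurable F -> cmeasurable (fun x => ntr (F x)).
Proof.
move=> mF; apply: cmeasurableM; last exact: cmeasurable_cst.
by apply: cmeasurable_sum => k; exact: mF.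
Qed.

End measurable_complex.

Section integrable_complex.
Context d (T : measurableType d) (R : realType) (mu : probability T R).
Implicit Types f g : T -> R[i].

Lemma cintegrable_measurable f : cintegrable mu f -> cmeasurable f.
Proof.
by move=> [/measurable_int f1 /measurable_int f2]; split;
  apply/measurable_EFinP.
Qed.

Lemma cintegrable_cst (z : R[i]) : cintegrable mu (fun=> z).
Proof. by split; exact: finite_measure_integrable_cst. Qed.

Lemma cintegral_cst (z : R[i]) : cintegral mu (fun=> z) = z.
Proof.
case: z => a b; rewrite /cintegral /=.
by rewrite !Rintegral_cst// ![fine _](congr1 fine (probability_setT mu))/= !mulr1.
Qed.

Lemma cintegrableD f g : cintegrable mu f -> cintegrable mu g ->
  cintegrable mu (fun x => f x + g x).
Proof.
move=> [f1 f2] [g1 g2]; split; under eq_fun do rewrite ?(cReD, cImD) EFinD;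
  exact: integrableD.
Qed.

Lemma cintegralD f g : cintegrable mu f -> cintegrable mu g ->
  cintegral mu (fun x => f x + g x) = cintegral mu f + cintegral mu g.
Proof.
move=> [f1 f2] [g1 g2]; rewrite /cintegral; apply: eq_complexP => /=.
- by under eq_Rintegral do rewrite cReD; rewrite RintegralD.
- by under eq_Rintegral do rewrite cImD; rewrite RintegralD.
Qed.

Lemma cintegrableZ (z : R[i]) f : cintegrable mu f ->
  cintegrable mu (fun x => z * f x).
Proof.
move=> [f1 f2]; split; under eq_fun do rewrite ?(cReM, cImM) ?(EFinD,EFinN) ?EFinM.
- by apply: integrableB => //; exact: integrableZl.
- by apply: integrableD => //; exact: integrableZl.
Qed.

Lemma cintegralZ (z : R[i]) f : cintegrable mu f ->
  cintegral mu (fun x => z * f x) = z * cintegral mu f.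
Proof.
have iZ (r : R) (h : T -> R) : mu.-integrable setT (EFin \o h) ->
    mu.-integrable setT (EFin \o (fun x => r * h x)).
  move=> ih; rewrite (_ : _ \o _ = fun x => (r%:E * (EFin \o h) x)%E)//.
  exact: integrableZl.
move=> [f1 f2]; rewrite /cintegral; apply: eq_complexP; rewrite ?cReM ?cImM /=.
- under eq_Rintegral do rewrite cReM.
  by rewrite RintegralB//; [rewrite !RintegralZl|exact: iZ|exact: iZ].
- under eq_Rintegral do rewrite cImM.
  by rewrite RintegralD//; [rewrite !RintegralZl|exact: iZ|exact: iZ].
Qed.

Lemma cintegrableJ f : cintegrable mu f ->
  cintegrable mu (fun x => Num.conj (f x)).
Proof.
move=> [f1 f2]; split; first by under eq_fun do rewrite cReJ.
rewrite (_ : (fun x => _) = -%E \o (fun x => (Im (f x))%:E)).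
  exact: integrableN.
by apply/funext => x; rewrite cImJ.
Qed.

Lemma cintegralJ f : cintegrable mu f ->
  cintegral mu (fun x => Num.conj (f x)) = Num.conj (cintegral mu f).
Proof.
move=> [f1 f2]; rewrite /cintegral; apply: eq_complexP; rewrite ?cReJ ?cImJ /=.
- by under eq_Rintegral do rewrite cReJ.
- under eq_Rintegral do rewrite cImJ -mulN1r.
  by rewrite RintegralZl// mulN1r.
Qed.

Lemma cintegrable_sum (I : Type) (s : seq I) (f : I -> T -> R[i]) :
  (forall k, cintegrable mu (f k)) ->
  cintegrable mu (fun x => \sum_(k <- s) f k x).
Proof.
move=> mf; elim: s => [|k s IH].
  by under eq_fun do rewrite big_nil; exact: cintegrable_cst.
by under eq_fun do rewrite big_cons; exact: cintegrableD.
Qed.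

Lemma cintegral_sum (I : Type) (s : seq I) (f : I -> T -> R[i]) :
  (forall k, cintegrable mu (f k)) ->
  cintegral mu (fun x => \sum_(k <- s) f k x) = \sum_(k <- s) cintegral mu (f k).
Proof.
move=> mf; elim: s => [|k s IH].
  by under eq_fun do rewrite big_nil; rewrite big_nil cintegral_cst.
under eq_fun do rewrite big_cons.
by rewrite big_cons cintegralD// ?IH//; exact: cintegrable_sum.
Qed.

Variable q : nat.
Implicit Types F G : T -> 'M[R[i]]_q.

Lemma mx_integrable_ext F (h : 'I_q -> 'I_q -> T -> R[i]) :
  (forall i j x, F x i j = h i j x) ->
  (forall i j, cintegrable mu (h i j)) -> mx_integrable mu F.
Proof. by move=> Fh hi i j; rewrite (_ : (fun x => _) = h i j)//; apply/funext. Qed.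

Lemma mx_integral_ext F (h : 'I_q -> 'I_q -> T -> R[i]) i j :
  (forall i j x, F x i j = h i j x) ->
  mx_integral mu F i j = cintegral mu (h i j).
Proof. by move=> Fh; rewrite mxE; congr cintegral; apply/funext. Qed.

Lemma mx_integral_cst (A : 'M[R[i]]_q) : mx_integral mu (fun=> A) = A.
Proof. by apply/matrixP => i j; rewrite mxE cintegral_cst. Qed.

Lemma mx_integrableD F G : mx_integrable mu F -> mx_integrable mu G ->
  mx_integrable mu (fun x => F x + G x).
Proof.
move=> mF mG.
apply: (@mx_integrable_ext _ (fun i j x => F x i j + G x i j)) => [i j x|i j].
  by rewrite mxE.
exact: cintegrableD.
Qed.

Lemma mx_integralD F G : mx_integrable mu F -> mx_integrable mu G ->
  mx_integral mu (fun x => F x + G x) = mx_integral mu F + mx_integral mu G.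
Proof.
move=> mF mG; apply/matrixP => i j.
rewrite (@mx_integral_ext _ (fun i j x => F x i j + G x i j)) => [|k l x].
  by rewrite cintegralD// !mxE.
by rewrite mxE.
Qed.

Lemma mx_integrable_mull (A : 'M[R[i]]_q) F : mx_integrable mu F ->
  mx_integrable mu (fun x => A *m F x).
Proof.
move=> mF.
apply: (@mx_integrable_ext _ (fun i j x => \sum_k A i k * F x k j)) => [i j x|i j].
  by rewrite mxE.
by apply: cintegrable_sum => k; exact: cintegrableZ.
Qed.

Lemma mx_integral_mull (A : 'M[R[i]]_q) F : mx_integrable mu F ->
  mx_integral mu (fun x => A *m F x) = A *m mx_integral mu F.
Proof.
move=> mF; apply/matrixP => i j.
rewrite (@mx_integral_ext _ (fun i j x => \sum_k A i k * F x k j)) => [|k l x].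
  rewrite cintegral_sum => [|k]; last exact: cintegrableZ.
  by rewrite mxE; apply: eq_bigr => k _; rewrite cintegralZ// mxE.
by rewrite mxE.
Qed.

Lemma mx_integrable_adj F : mx_integrable mu F ->
  mx_integrable mu (fun x => (F x)^t*).
Proof.
move=> mF.
apply: (@mx_integrable_ext _ (fun i j x => Num.conj (F x j i))) => [i j x|i j].
  by rewrite !mxE.
exact: cintegrableJ.
Qed.

Lemma mx_integral_adj F : mx_integrable mu F ->
  mx_integral mu (fun x => (F x)^t*) = (mx_integral mu F)^t*.
Proof.
move=> mF; apply/matrixP => i j.
rewrite (@mx_integral_ext _ (fun i j x => Num.conj (F x j i))) => [|k l x].
  by rewrite cintegralJ// !mxE.
by rewrite !mxE.
Qed.

Lemma cintegrable_tr F : mx_integrable mu F ->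
  cintegrable mu (fun x => ntr (F x)).
Proof.
move=> mF; rewrite (_ : (fun x => _) = fun x => q%:R^-1 * \sum_i F x i i).
  by apply: cintegrableZ; exact: cintegrable_sum.
by apply/funext => x; rewrite mulrC.
Qed.

Lemma ntr_integral F : mx_integrable mu F ->
  ntr (mx_integral mu F) = cintegral mu (fun x => ntr (F x)).
Proof.
move=> mF; rewrite (_ : (fun x => ntr _) = fun x => q%:R^-1 * \sum_i F x i i).
  rewrite cintegralZ; last exact: cintegrable_sum.
  rewrite cintegral_sum// /ntr mulrC; congr (_ * _).
  by apply: eq_bigr => k _; rewrite mxE.
by apply/funext => x; rewrite mulrC.
Qed.

End integrable_complex.

(** * Nontrivial characters have integral zero *)

Section character_integral.
Context (R : realType) (G : zmodType).

Lemma Re_continuous : continuous (fun z : (R[i])^o => Re z : R).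
Proof.
move=> z; have := nbhs_pfilter (z : (R[i])^o); set nz := nbhs _ => Fz.
apply/cvgrPdist_lt => e e0.
have e0' : (0 : R[i]) < e%:C by rewrite ltcR.
near=> w.
have : `|z - w| < e%:C by near: w; exact: (@nbhsx_ballx _ (R[i])^o z e%:C e0').
rewrite -ltcR; apply: le_lt_trans.
rewrite -[Re z - Re w]/(Re z + - Re w) (_ : _ + _ = Re (z - w)).
  exact: normc_ge_Re.
by case: (z) (w) => [? ?] [].
Unshelve. all: by end_near. Qed.

Lemma Im_continuous : continuous (fun z : (R[i])^o => Im z : R).
Proof.
move=> z; have := nbhs_pfilter (z : (R[i])^o); set nz := nbhs _ => Fz.
apply/cvgrPdist_lt => e e0.
have e0' : (0 : R[i]) < e%:C by rewrite ltcR.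
near=> w.
have : `|z - w| < e%:C by near: w; exact: (@nbhsx_ballx _ (R[i])^o z e%:C e0').
rewrite -ltcR; apply: le_lt_trans.
rewrite -[Im z - Im w]/(Im z + - Im w) (_ : _ + _ = - Re ((z - w) * 'i%C)).
  rewrite normrN; apply: le_trans (normc_ge_Re _) _.
  rewrite normrM (_ : `|'i%C| = 1 :> R[i]) ?mulr1//.
  by rewrite normc_def/= expr0n expr1n add0r sqrtr1.
by case: (z) (w) => [? ?] [? ?] /=; ring.
Unshelve. all: by end_near. Qed.

Lemma char_eval_continuous (g : G) : continuous (fun x : dual R G => (x g : (R[i])^o)).
Proof.
move=> x; apply: (@continuous_comp (dual R G) {ptws G -> (R[i])^o} (R[i])^o
  (@dual_eval R G) (fun f => f g)).
  exact: initial_continuous.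
exact: (@proj_continuous G (fun=> (R[i])^o) g).
Qed.

Lemma dual_measurable_fun (f : dual R G -> R) : continuous f ->
  measurable_fun setT (f : borel_dual R G -> R).
Proof.
move=> cf.
apply: (measurability _ (RGenOpens.measurableE R)) => //.
move=> _ [U oU <-]; rewrite setTI; apply: sub_sigma_algebra.
by move/continuousP: cf; apply; case: oU => [a [b ->]]; exact: interval_open.
Qed.

Lemma char_eval_measurable (g : G) :
  cmeasurable (fun x : borel_dual R G => (x : dual R G) g).
Proof.
split; apply: dual_measurable_fun => x.
- by apply: (continuous_comp (@char_eval_continuous g x)); exact: Re_continuous.
- by apply: (continuous_comp (@char_eval_continuous g x)); exact: Im_continuous.
Qed.

End character_integral.

Section haar_orthogonality.
Context (R : realType) (G : zmodType).

Lemma dual_ext (x y : dual R G) : (forall g, x g = y g) -> x = y.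
Proof.
case: x y => [x x1 xm] [y y1 ym] /= /funext xy; move: x1 xm y1 ym.
by rewrite xy => *; congr Character; exact: Prop_irrelevance.
Qed.

Lemma char_conj_norm1 (x : dual R G) g : `|Num.conj (x g)| = 1.
Proof. by rewrite norm_conjC char_norm1. Qed.

Lemma char_conj_morph (x : dual R G) g h :
  Num.conj (x (g + h)) = Num.conj (x g) * Num.conj (x h).
Proof. by rewrite char_morph rmorphM. Qed.

Definition dual_inv (x : dual R G) : dual R G :=
  Character (char_conj_norm1 x) (char_conj_morph x).

Lemma char_mulJ (x : dual R G) g : x g * Num.conj (x g) = 1.
Proof. by rewrite -normCK char_norm1 expr1n. Qed.

Lemma dual_mulK (x y : dual R G) : dual_mul (dual_inv x) (dual_mul x y) = y.
Proof. by apply: dual_ext => g /=; rewrite mulrA [_ * x g]mulrC char_mulJ mul1r. Qed.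

Lemma dual_mulVK (x y : dual R G) : dual_mul x (dual_mul (dual_inv x) y) = y.
Proof. by apply: dual_ext => g /=; rewrite mulrA char_mulJ mul1r. Qed.

Variables (mu : probability (borel_dual R G) R) (mu_haar : haar mu).

(** The preimage of A under a translation is its image under the inverse
    translation, to which invariance applies. *)
Lemma haar_shift_measure (x : dual R G) (A : set (borel_dual R G)) :
  measurable A -> mu [set y | A (dual_mul x y)] = mu A.
Proof.
case: mu_haar => mu_inv _ _ mA; rewrite -(mu_inv (dual_inv x) A mA); congr (mu _).
apply/seteqP; split => [y Axy|_ [y Ay <-]] /=.
  by exists (dual_mul x y) => //; exact: dual_mulK.
by rewrite dual_mulVK.
Qed.

(** Both integrals are integrals of the identity of R against the image
    measures under f and f', and these measures agree by invariance. *)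
Lemma haar_shift_integral (x : dual R G) (f f' : borel_dual R G -> R) :
  measurable_fun setT f -> measurable_fun setT f' ->
  mu.-integrable setT (EFin \o f) -> mu.-integrable setT (EFin \o f') ->
  (forall y : dual R G, f' y = f (dual_mul x y)) ->
  \int[mu]_y f' y = \int[mu]_y f y.
Proof.
move=> mf mf' intf intf' ff'; congr fine.
have := @integral_pushforward _ _ _ _ R f mf mu setT EFin.
have := @integral_pushforward _ _ _ _ R f' mf' mu setT EFin.
move=> /(_ (@EFin_measurable R setT) intf' measurableT) /= <-.
move=> /(_ (@EFin_measurable R setT) intf measurableT) /= <-.
apply: eq_measure_integral => A mA _; rewrite /pushforward.
have mfA : measurable (f @^-1` A) by rewrite -[_ @^-1` _]setTI; exact: mf.
apply: etrans (haar_shift_measure x mfA).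
by congr (mu _); apply/seteqP; split => y /=; rewrite ff'.
Qed.

Lemma norm1_Re_Im (z : R[i]) : `|z| = 1 -> `|Re z| <= 1 /\ `|Im z| <= 1.
Proof.
move=> z1; split; first by rewrite -lecR (le_trans (normc_ge_Re z)) ?z1.
rewrite -normrN (_ : - Im z = Re (z * 'i%C)); last by case: (z) => a b /=; ring.
rewrite -lecR (le_trans (normc_ge_Re _))// normrM z1 mul1r normc_def/=.
by rewrite expr0n expr1n add0r sqrtr1.
Qed.

Lemma cintegrable_norm1 (f : borel_dual R G -> R[i]) : cmeasurable f ->
  (forall y, `|f y| = 1) -> cintegrable mu f.
Proof.
move=> [mf1 mf2] f1.
have i1 : mu.-integrable setT (EFin \o (fun=> 1 : R)).
  exact: finite_measure_integrable_cst.
by split; apply: (le_integrable measurableT _ _ i1) => [|y _];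
  [exact/measurable_EFinP|rewrite /= lee_fin normr1 (norm1_Re_Im (f1 y)).1
  |exact/measurable_EFinP|rewrite /= lee_fin normr1 (norm1_Re_Im (f1 y)).2].
Qed.

Lemma cintegrable_char (g : G) :
  cintegrable mu (fun x : borel_dual R G => (x : dual R G) g).
Proof.
apply: cintegrable_norm1; first exact: char_eval_measurable.
by move=> y; rewrite char_norm1.
Qed.

(** Translating by x multiplies the integral by x g, and some x has x g <>
    1. *)
Lemma cintegral_char (g : G) : g != 0 ->
  cintegral mu (fun x : borel_dual R G => (x : dual R G) g) = 0.
Proof.
move=> g0; have [x xg] := @character_separation R G g g0.
set f := fun y => _; have intf : cintegrable mu f by exact: cintegrable_char.
have intxf : cintegrable mu (fun y => x g * f y) by exact: cintegrableZ.
suff : x g * cintegral mu f = cintegral mu f.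
  rewrite -[RHS]mul1r => /eqP; rewrite -subr_eq0 -mulrBl mulf_eq0 subr_eq0.
  by rewrite (negbTE xg) => /eqP.
rewrite -cintegralZ//.
have [[m1 m2] [m1' m2']] := (cintegrable_measurable intf, cintegrable_measurable intxf).
case: intf intxf => [i1 i2] [i1' i2'].
by apply: eq_complexP; rewrite /cintegral/=; apply: (@haar_shift_integral x).
Qed.

End haar_orthogonality.

(** * The form of a positive definite matrix *)

Section weighted_form.
Context (R : realType) (q : nat).
Implicit Types (W A B F G K : 'M[R[i]]_q) (v w : 'rV[R[i]]_q).

Lemma adjmxM (m n p : nat) (A : 'M[R[i]]_(m, n)) (B : 'M[R[i]]_(n, p)) :
  (A *m B)^t* = B^t* *m A^t*.
Proof. by rewrite trmx_mul map_mxM. Qed.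

Lemma adjmxK (m n : nat) (A : 'M[R[i]]_(m, n)) : (A^t*)^t* = A.
Proof. by apply/matrixP => i j; rewrite !mxE conjCK. Qed.

Lemma adjmxD (m n : nat) (A B : 'M[R[i]]_(m, n)) : (A + B)^t* = A^t* + B^t*.
Proof. by rewrite linearD/= map_mxD. Qed.

Lemma adjmxZ (m n : nat) (z : R[i]) (A : 'M[R[i]]_(m, n)) :
  (z *: A)^t* = Num.conj z *: A^t*.
Proof. by apply/matrixP => i j; rewrite !mxE rmorphM. Qed.

Lemma posdef_herm W : posdefmx W -> W^t* = W.
Proof. by case=> /is_hermitianmxP; rewrite expr0 scale1r. Qed.

(** A vector in the kernel would have value 0 in the form. *)
Lemma posdef_unit W : posdefmx W -> W \in unitmx.
Proof.
case=> _ Wpos; rewrite -row_free_unit; apply: contraT => Wfree.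
have [v vn0 vW] : exists2 v : 'rV_q, v != 0 & v *m W = 0.
  move: Wfree; rewrite -kermx_eq0 => /rowV0Pn[v /sub_kermxP vW vn0].
  by exists v.
by have := Wpos v vn0; rewrite vW mul0mx mxE ltxx.
Qed.

Lemma adj_invmx W : posdefmx W -> (invmx W)^t* = invmx W.
Proof.
move=> Wpos; rewrite -[RHS](congr1 invmx (posdef_herm Wpos)).
by rewrite trmx_inv map_invmx.
Qed.

Lemma posdef_inv W : posdefmx W -> posdefmx (invmx W).
Proof.
move=> Wpos; have Wu := posdef_unit Wpos; split.
  by apply/is_hermitianmxP; rewrite expr0 scale1r adj_invmx.
move=> v v0; have -> : v *m invmx W *m v^t* =
    (v *m invmx W) *m W *m (v *m invmx W)^t*.
  by rewrite mulmxKV// adjmxM adj_invmx// mulmxA.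
apply: Wpos.2; apply: contra_neq v0 => h.
by rewrite -[v](mulmxKV Wu) h mul0mx.
Qed.

Definition rowform W v w : R[i] := (v *m W *m w^t*) 0 0.

Lemma rowform_ge0 W v : posdefmx W -> 0 <= rowform W v v.
Proof.
move=> [_ Wpos]; have [->|/Wpos/ltW//] := eqVneq v 0.
by rewrite /rowform !mul0mx mxE.
Qed.

Lemma rowformE W F G i j :
  (F *m W *m G^t*) i j = rowform W (row i F) (row j G).
Proof.
rewrite /rowform -row_mul !mxE; apply: eq_bigr => k _; by rewrite !mxE.
Qed.

Lemma form_adj W F G : posdefmx W -> (F *m W *m G^t*)^t* = G *m W *m F^t*.
Proof. by move=> Wpos; rewrite !adjmxM adjmxK posdef_herm// mulmxA. Qed.

Lemma rowform_conj W v w : posdefmx W ->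
  rowform W w v = Num.conj (rowform W v w).
Proof.
move=> Wpos; have -> : rowform W w v = ((v *m W *m w^t*)^t*) 0 0.
  by rewrite !adjmxM adjmxK posdef_herm// mulmxA.
by rewrite mxE mxE.
Qed.

Lemma rowformDl W v v' w : rowform W (v + v') w = rowform W v w + rowform W v' w.
Proof. by rewrite /rowform !mulmxDl mxE. Qed.

Lemma rowformZl W z v w : rowform W (z *: v) w = z * rowform W v w.
Proof. by rewrite /rowform -!scalemxAl mxE. Qed.

Lemma rowformDr W v w w' : rowform W v (w + w') = rowform W v w + rowform W v w'.
Proof. by rewrite /rowform adjmxD mulmxDr mxE. Qed.

Lemma rowformZr W z v w : rowform W v (z *: w) = Num.conj z * rowform W v w.
Proof. by rewrite /rowform adjmxZ -scalemxAr mxE. Qed.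

Lemma rowform_Im W v : posdefmx W -> Im (rowform W v v) = 0.
Proof. by move=> /rowform_ge0 => /(_ v) /ger0_Im. Qed.

Lemma rowform_Re_ge0 W v : posdefmx W -> 0 <= Re (rowform W v v).
Proof. by move=> /rowform_ge0 => /(_ v); rewrite lecE => /andP[]. Qed.

Lemma Re_rowform_le W v w (z : R[i]) (t : R) : posdefmx W -> 0 < t ->
  z * Num.conj z = 1 ->
  Re (Num.conj z * rowform W v w) <=
    (t^-1 * Re (rowform W v v) + t * Re (rowform W w w)) / 2.
Proof.
(* Positivity at the vector v - t z w. *)
move=> Wpos t0 z1; have := rowform_Re_ge0 (v + (- (t%:C * z)) *: w) Wpos.
rewrite rowformDl !rowformDr !rowformZl !rowformZr (rowform_conj v w Wpos).
have -> : Num.conj (- (t%:C * z)) = - (t%:C * Num.conj z).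
  by rewrite rmorphN rmorphM/= (_ : Num.conj t%:C = t%:C)//; apply: conjc_real.
have -> : - (t%:C * z) * (- (t%:C * Num.conj z) * rowform W w w) =
    (t ^+ 2)%:C * rowform W w w.
  by rewrite rmorphXn/= -[in RHS](mulr1 (_ ^+ 2)) -z1; ring.
have := rowform_Im w Wpos; have := rowform_Im v Wpos.
set a := rowform W v v; set b := rowform W w w; set c := rowform W v w.
move=> a0 b0; rewrite !cReD.
have -> : Re (- (t%:C * z) * Num.conj c) = - t * Re (Num.conj z * c).
  by case: (z) (c) => [x y] [x' y'] /=; ring.
have -> : Re (- (t%:C * Num.conj z) * c) = - t * Re (Num.conj z * c).
  by case: (z) (c) => [x y] [x' y'] /=; ring.
have -> : Re ((t ^+ 2)%:C * b) = t ^+ 2 * Re b by case: (b) => x y /=; ring.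
set r := Re (_ * c) => h.
rewrite -subr_ge0.
have -> : (t^-1 * Re a + t * Re b) / 2 - r =
    t^-1 / 2 * (Re a + - t * r + (- t * r + t ^+ 2 * Re b)).
  by field; rewrite gt_eqF.
by rewrite mulr_ge0// divr_ge0// invr_ge0 ltW.
Qed.

(** The Cauchy-Schwarz inequality in additive form. The weight t stays free,
    so that after integration it can be adapted to the size of v and w. *)
Lemma rowform_bound W v w (t : R) : posdefmx W -> 0 < t ->
  let b := (t^-1 * Re (rowform W v v) + t * Re (rowform W w w)) / 2 in
  `|Re (rowform W v w)| <= b /\ `|Im (rowform W v w)| <= b.
Proof.
move=> Wpos t0 /=; rewrite !ler_norml.
have h z := @Re_rowform_le W v w z t Wpos t0.
(* The factors 1, -1, i and -i give upper bounds of plus and minus the real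
   and imaginary parts. *)
have := h 1; have := h (-1); have := h 'i%C; have := h (- 'i%C).
rewrite !rmorphN !rmorph1 !mulrNN mulr1.
have ii : 'i%C * Num.conj 'i%C = 1 :> R[i] by apply: eq_complexP => /=; ring.
move=> /(_ ii) h1 /(_ ii) h2 /(_ erefl) h3 /(_ erefl) h4.
move: h1 h2 h3 h4; set c := rowform W v w; set b := _ / 2.
rewrite !mulN1r mul1r.
have -> : Re (- Num.conj 'i%C * c) = - Im c by case: (c) => x y /=; ring.
have -> : Re (Num.conj 'i%C * c) = Im c by case: (c) => x y /=; ring.
have -> : Re (- c) = - Re c by case: (c).
by move=> h1 h2 h3 h4; split; lra.
Qed.

Lemma form_bound W F G i j (t : R) : posdefmx W -> 0 < t ->
  let b := (t^-1 * Re ((F *m W *m F^t*) i i) + t * Re ((G *m W *m G^t*) j j)) / 2 in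
  `|Re ((F *m W *m G^t*) i j)| <= b /\ `|Im ((F *m W *m G^t*) i j)| <= b.
Proof. by move=> Wpos t0 /=; rewrite !rowformE; exact: rowform_bound. Qed.

Lemma form_diag_ge0 W F i : posdefmx W -> 0 <= Re ((F *m W *m F^t*) i i).
Proof. by move=> Wpos; rewrite rowformE; exact: rowform_Re_ge0. Qed.

Lemma ntr_form_Im W F : posdefmx W -> Im (ntr (F *m W *m F^t*)) = 0.
Proof.
move=> Wpos; apply: ger0_Im; rewrite mulr_ge0 ?invr_ge0//.
by apply: sumr_ge0 => i _; rewrite rowformE; exact: rowform_ge0.
Qed.

Lemma Re_ntr A : Re (ntr A) = (\sum_i Re (A i i)) / q%:R.
Proof.
rewrite /ntr -cRe_sum /mxtrace.
have -> : q%:R^-1 = (q%:R^-1)%:C :> R[i] by rewrite fmorphV rmorph_nat.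
by rewrite cReM /= mulr0 subr0.
Qed.

Lemma form_diag_le_ntr W F i : (0 < q)%N -> posdefmx W ->
  Re ((F *m W *m F^t*) i i) <= q%:R * Re (ntr (F *m W *m F^t*)).
Proof.
move=> q0 Wpos; rewrite Re_ntr mulrC divfK ?pnatr_eq0 ?gt_eqF//.
rewrite (bigD1 i)//= lerDl; apply: sumr_ge0 => k _; exact: form_diag_ge0.
Qed.

Lemma Re_ntr_form_ge0 W F : posdefmx W -> 0 <= Re (ntr (F *m W *m F^t*)).
Proof.
move=> Wpos; rewrite Re_ntr divr_ge0//; apply: sumr_ge0 => k _.
exact: form_diag_ge0.
Qed.

(** An entry of F is a value of the form of W at F and W^-1; since the value
    at W^-1 twice is W^-1 itself ([invmx_form]), [form_bound] controls F by
    its weighted square and by W^-1. *)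
Lemma entry_form W F i j : posdefmx W ->
  F i j = (F *m W *m (invmx W)^t*) i j.
Proof. by move=> Wpos; rewrite adj_invmx// mulmxK// posdef_unit. Qed.

Lemma invmx_form W : posdefmx W -> invmx W *m W *m (invmx W)^t* = invmx W.
Proof. by move=> Wpos; rewrite adj_invmx// mulVmx ?posdef_unit// mul1mx. Qed.

End weighted_form.

(** * The weighted space and its inner product *)

Section normalized_trace.
Context (R : realType) (q : nat).
Implicit Types A B : 'M[R[i]]_q.

Lemma ntrD A B : ntr (A + B) = ntr A + ntr B.
Proof. by rewrite /ntr linearD/= mulrDl. Qed.

Lemma ntrZ (z : R[i]) A : ntr (z *: A) = z * ntr A.
Proof. by rewrite /ntr linearZ/= mulrA. Qed.

Lemma ntr_adj A : ntr (A^t*) = Num.conj (ntr A).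
Proof.
rewrite /ntr rmorphM fmorphV rmorph_nat; congr (_ / _).
by rewrite /mxtrace rmorph_sum; apply: eq_bigr => i _; rewrite !mxE.
Qed.

Lemma ntr1 : (0 < q)%N -> ntr (1%:M : 'M[R[i]]_q) = 1.
Proof. by move=> q0; rewrite /ntr mxtrace1 divff// pnatr_eq0 gt_eqF. Qed.

Lemma Re_ntr_normsq A : Re (ntr (A *m A^t*)) =
  (\sum_i \sum_j (Re (A i j) ^+ 2 + Im (A i j) ^+ 2)) / q%:R.
Proof.
rewrite Re_ntr; congr (_ / _); apply: eq_bigr => i _; rewrite mxE cRe_sum.
apply: eq_bigr => j _; rewrite !mxE cReM cReJ cImJ; ring.
Qed.

Lemma Re_ntr_eq0 A : Re (ntr (A *m A^t*)) = 0 -> A = 0.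
Proof.
rewrite Re_ntr_normsq => h; apply/matrixP => i j; rewrite mxE.
have q0 : q%:R != 0 :> R by rewrite pnatr_eq0; case: (q) i => // -[].
move: h => /eqP; rewrite mulf_eq0 invr_eq0 (negbTE q0) orbF.
have ge0 k l : 0 <= Re (A k l) ^+ 2 + Im (A k l) ^+ 2 by rewrite addr_ge0 ?sqr_ge0.
rewrite psumr_eq0 => [/allP/(_ i (mem_index_enum i))/=|k _]; last exact: sumr_ge0.
rewrite psumr_eq0 => [/allP/(_ j (mem_index_enum j))/=|l _]; last exact: ge0.
rewrite paddr_eq0 ?sqr_ge0// !sqrf_eq0 => /andP[/eqP ? /eqP ?].
exact: eq_complexP.
Qed.

End normalized_trace.

Section weighted_L2.
Context d (T : measurableType d) (R : realType) (mu : probability T R).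
Context (q : nat) (q_gt0 : (0 < q)%N) (W : T -> 'M[R[i]]_q).
Hypothesis W_weight : weight mu W.
Implicit Types F G K : T -> 'M[R[i]]_q.

Let Wpos x : posdefmx (W x). Proof. exact: W_weight.2. Qed.

Lemma mx_integrable_measurable F : mx_integrable mu F -> mx_measurable F.
Proof. by move=> iF i j; exact: cintegrable_measurable (iF i j). Qed.

Let W_meas : mx_measurable W.
Proof. by apply: mx_integrable_measurable; exact: W_weight.1. Qed.

Lemma mx_integrable_mulr (A : 'M[R[i]]_q) F : mx_integrable mu F ->
  mx_integrable mu (fun x => F x *m A).
Proof.
move=> iF; have := mx_integrable_adj (mx_integrable_mull (A^t*) (mx_integrable_adj iF)).
apply: mx_integrable_ext => i j x; by rewrite adjmxM !adjmxK.
Qed.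

Lemma cintegrable_le (f : T -> R[i]) (g : T -> R) : cmeasurable f ->
  mu.-integrable setT (EFin \o g) ->
  (forall x, `|Re (f x)| <= g x /\ `|Im (f x)| <= g x) -> cintegrable mu f.
Proof.
move=> [mf1 mf2] ig fg.
have g0 x : 0 <= g x by apply: le_trans (fg x).1.
by split; apply: (le_integrable measurableT _ _ ig) => [|x _];
  [exact/measurable_EFinP|rewrite /= lee_fin (ger0_norm (g0 x)) (fg x).1
  |exact/measurable_EFinP|rewrite /= lee_fin (ger0_norm (g0 x)) (fg x).2].
Qed.

Lemma mx_measurable_form F G : mx_measurable F -> mx_measurable G ->
  mx_measurable (fun x => F x *m W x *m (G x)^t*).
Proof.
move=> mF mG; apply: mx_measurableM; first exact: mx_measurableM.
exact: mx_measurable_adj.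
Qed.

(** With weight t = 1 the additive Cauchy-Schwarz inequality dominates every
    entry by diagonal entries, which are nonnegative and therefore at most q
    times the normalized traces. *)
Lemma mx_integrable_form F G : L2 mu W F -> L2 mu W G ->
  mx_integrable mu (fun x => F x *m W x *m (G x)^t*).
Proof.
move=> [mF [iF _]] [mG [iG _]] i j.
pose g x := q%:R / 2 * (Re (ntr (F x *m W x *m (F x)^t*)) +
                        Re (ntr (G x *m W x *m (G x)^t*))).
apply: (@cintegrable_le _ g); first exact: mx_measurable_form.
  rewrite (_ : EFin \o g = fun x => ((q%:R / 2)%:E *
    ((Re (ntr (F x *m W x *m (F x)^t*)))%:E +
     (Re (ntr (G x *m W x *m (G x)^t*)))%:E))%E)//.
  by apply: integrableZl => //; exact: integrableD.
move=> x; have := form_bound (F x) (G x) i j (Wpos x) ltr01 => /=.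
have := form_diag_le_ntr (F x) i q_gt0 (Wpos x).
have := form_diag_le_ntr (G x) j q_gt0 (Wpos x).
rewrite /g invr1 !mul1r => h1 h2 [h3 h4].
by split; [apply: le_trans h3 _|apply: le_trans h4 _]; lra.
Qed.

Lemma L2_intro F : mx_measurable F ->
  mx_integrable mu (fun x => F x *m W x *m (F x)^t*) -> L2 mu W F.
Proof. by move=> mF iF; split => //; exact: cintegrable_tr. Qed.

Lemma L2D F G : L2 mu W F -> L2 mu W G -> L2 mu W (F + G).
Proof.
move=> LF LG; apply: L2_intro; first by case: LF LG => mF _ [mG _];
  exact: mx_measurableD.
have := mx_integrableD
  (mx_integrableD (mx_integrable_form LF LF) (mx_integrable_form LF LG))
  (mx_integrableD (mx_integrable_form LG LF) (mx_integrable_form LG LG)).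
apply: mx_integrable_ext => i j x; congr (fun_of_matrix _ i j).
by rewrite adjmxD !mulmxDl !mulmxDr.
Qed.

Lemma L2_mull (A : 'M[R[i]]_q) F : L2 mu W F -> L2 mu W (fun x => A *m F x).
Proof.
move=> LF; apply: L2_intro.
  by apply: mx_measurableM; [exact: mx_measurable_cst|case: LF].
have := mx_integrable_mulr (A^t*) (mx_integrable_mull A (mx_integrable_form LF LF)).
apply: mx_integrable_ext => i j x; congr (fun_of_matrix _ i j).
by rewrite adjmxM !mulmxA.
Qed.

Lemma L2Z (z : R[i]) F : L2 mu W F -> L2 mu W (z *: F).
Proof.
move=> /(L2_mull z%:M); congr (L2 _ _); apply/funext => x.
by rewrite mul_scalar_mx.
Qed.

Lemma L2_cst (A : 'M[R[i]]_q) : L2 mu W (cst A).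
Proof.
apply: L2_intro; first exact: mx_measurable_cst.
exact: (mx_integrable_mulr (A^t*) (mx_integrable_mull A W_weight.1)).
Qed.

Lemma L2_0 : L2 mu W 0.
Proof. exact: (L2_cst 0). Qed.

Lemma innerDl F G K : L2 mu W F -> L2 mu W G -> L2 mu W K ->
  inner mu W (F + G) K = inner mu W F K + inner mu W G K.
Proof.
move=> LF LG LK; rewrite /inner -mx_integralD; [|exact: mx_integrable_form..].
by congr mx_integral; apply/funext => x; rewrite !mulmxDl.
Qed.

Lemma inner_mull (A : 'M[R[i]]_q) F K : L2 mu W F -> L2 mu W K ->
  inner mu W (fun x => A *m F x) K = A *m inner mu W F K.
Proof.
move=> LF LK; rewrite /inner -mx_integral_mull; last exact: mx_integrable_form.
by congr mx_integral; apply/funext => x; rewrite !mulmxA.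
Qed.

Lemma innerZl (z : R[i]) F K : L2 mu W F -> L2 mu W K ->
  inner mu W (z *: F) K = z *: inner mu W F K.
Proof.
move=> LF LK; have -> : z *: F = (fun x => z%:M *m F x).
  by apply/funext => x; rewrite mul_scalar_mx.
by rewrite (inner_mull _ LF LK) mul_scalar_mx.
Qed.

Lemma inner_adj F K : L2 mu W F -> L2 mu W K ->
  inner mu W K F = (inner mu W F K)^t*.
Proof.
move=> LF LK; rewrite /inner -mx_integral_adj; last exact: mx_integrable_form.
by congr mx_integral; apply/funext => x; rewrite form_adj.
Qed.

(** The real inner product behind [L2norm]. On left modules orthogonality
    for it is the same as for the matrix-valued inner product ([inner_eq0]). *)
Definition Re_inner F G : R := Re (ntr (inner mu W F G)).

Lemma Re_innerE F : L2 mu W F ->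
  Re_inner F F = \int[mu]_x Re (ntr (F x *m W x *m (F x)^t*)).
Proof. by move=> LF; rewrite /Re_inner ntr_integral//; exact: mx_integrable_form. Qed.

Lemma Re_inner_semi : semi_inner_product (L2 mu W) Re_inner.
Proof.
split.
- exact: L2_0.
- exact: L2D.
- by move=> t u; exact: L2Z.
- by move=> u v w Lu Lv Lw; rewrite /Re_inner innerDl// ntrD cReD.
- by move=> t u w Lu Lw; rewrite /Re_inner innerZl// ntrZ cReM/= mul0r subr0.
- by move=> u v Lu Lv; rewrite /Re_inner inner_adj// ntr_adj cReJ.
- move=> u Lu; rewrite Re_innerE//; apply: Rintegral_ge0 => x _.
  exact: Re_ntr_form_ge0.
Qed.

Lemma L2norm_seminorm F : L2norm mu W F = seminorm Re_inner F.
Proof. by []. Qed.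

Lemma Re_inner_mull (A : 'M[R[i]]_q) F K : L2 mu W F -> L2 mu W K ->
  Re_inner (fun x => A *m F x) K = Re (ntr (A *m inner mu W F K)).
Proof. by move=> LF LK; rewrite /Re_inner inner_mull. Qed.

(** For A = (F, K), the product of F with A K is the sum of the squared
    moduli of the entries of A, divided by q. *)
Lemma inner_eq0 F K : L2 mu W F -> L2 mu W K ->
  (forall A : 'M[R[i]]_q, Re_inner F (fun x => A *m K x) = 0) -> inner mu W F K = 0.
Proof.
move=> LF LK h; apply: Re_ntr_eq0; have := h (inner mu W F K).
rewrite (ipC Re_inner_semi LF (L2_mull _ LK)) (Re_inner_mull _ LK LF).
by rewrite (inner_adj LF LK).
Qed.

Lemma L2normZ (z : R[i]) F : L2 mu W F ->
  (L2norm mu W (z *: F))%:C = `|z| * (L2norm mu W F)%:C.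
Proof.
move=> LF; have LzF := L2Z z LF.
rewrite /L2norm (innerZl z LF LzF) (inner_adj LzF LF) (innerZl z LF LF).
rewrite adjmxZ -(inner_adj LF LF) ntrZ ntrZ mulrA.
rewrite -normCK normc_def -rmorphXn/= sqr_sqrtr ?addr_ge0 ?sqr_ge0//.
rewrite cReM/= mul0r subr0 sqrtrM ?addr_ge0 ?sqr_ge0// rmorphM//.
Qed.

End weighted_L2.

(** * Completeness of the weighted space *)

Section complex_sequences.
Context (R : realType).
Implicit Types (s t : nat -> R[i]) (z w : R[i]).

Definition ccvg s z :=
  Re (s n) @[n --> \oo] --> Re z /\ Im (s n) @[n --> \oo] --> Im z.

Lemma ccvg_cst z : ccvg (fun=> z) z.
Proof. by split; exact: cvg_cst. Qed.

Lemma ccvgD s t z w : ccvg s z -> ccvg t w -> ccvg (fun n => s n + t n) (z + w).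
Proof.
move=> [s1 s2] [t1 t2]; split; rewrite ?cReD ?cImD;
  under eq_fun do rewrite ?cReD ?cImD; exact: cvgD.
Qed.

Lemma ccvgM s t z w : ccvg s z -> ccvg t w -> ccvg (fun n => s n * t n) (z * w).
Proof.
move=> [s1 s2] [t1 t2]; split; rewrite ?cReM ?cImM;
  under eq_fun do rewrite ?cReM ?cImM.
- by apply: cvgB; exact: cvgM.
- by apply: cvgD; exact: cvgM.
Qed.

Lemma ccvgJ s z : ccvg s z -> ccvg (fun n => Num.conj (s n)) (Num.conj z).
Proof.
move=> [s1 s2]; split; first by rewrite cReJ; under eq_fun do rewrite cReJ.
by rewrite cImJ; under eq_fun do rewrite cImJ; exact: cvgN.
Qed.

Lemma ccvg_sum (I : Type) (r : seq I) (s : I -> nat -> R[i]) (z : I -> R[i]) :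
  (forall k, ccvg (s k) (z k)) ->
  ccvg (fun n => \sum_(k <- r) s k n) (\sum_(k <- r) z k).
Proof.
move=> sz; elim: r => [|k r IH].
  by rewrite big_nil; under eq_fun do rewrite big_nil; exact: ccvg_cst.
by rewrite big_cons; under eq_fun do rewrite big_cons; exact: ccvgD.
Qed.

Lemma ccvg_ntr_form (q : nat) (W : 'M[R[i]]_q) (s : nat -> 'M[R[i]]_q)
    (l : 'M[R[i]]_q) :
  (forall i j, ccvg (fun n => s n i j) (l i j)) ->
  ccvg (fun n => ntr (s n *m W *m (s n)^t*)) (ntr (l *m W *m l^t*)).
Proof.
move=> sl; apply: ccvgM; last exact: ccvg_cst.
apply: ccvg_sum => k; rewrite mxE; under eq_fun do rewrite mxE.
apply: ccvg_sum => k'; apply: ccvgM; last first.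
  by rewrite !mxE; under eq_fun do rewrite !mxE; exact: ccvgJ.
rewrite mxE; under eq_fun do rewrite mxE.
by apply: ccvg_sum => k''; apply: ccvgM => //; exact: ccvg_cst.
Qed.

End complex_sequences.

Section series_facts.
Context (R : realType).

Lemma cvgn_of_summable_increments (a b : nat -> R) (c : R) :
  (forall n, `|a n.+1 - a n| <= b n) ->
  (forall n, \sum_(0 <= k < n) b k <= c) -> cvgn a.
Proof.
move=> ab bc; rewrite (_ : a = (fun n => a 0%N + series (telescope a) n)); last first.
  by apply/funext => n; rewrite -eq_sum_telescope.
apply: is_cvgD; first exact: is_cvg_cst.
apply: normed_cvg; apply: nondecreasing_is_cvgn.
  apply/nondecreasing_seqP => n.
  suff : \sum_(0 <= k < n) `|telescope a k| <=
    \sum_(0 <= k < n.+1) `|telescope a k| by [].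
  by rewrite big_nat_recr//= lerDl.
exists c => _ [n _ <-]; apply: le_trans (bc n).
by apply: ler_sum => k _; exact: ab.
Qed.

End series_facts.

Section completeness.
Context d (T : measurableType d) (R : realType) (mu : probability T R).
Context (q : nat) (q_gt0 : (0 < q)%N) (W : T -> 'M[R[i]]_q).
Hypothesis W_iw : inv_weight mu W.

Let W_weight : weight mu W. Proof. exact: W_iw.1. Qed.
Let Wpos x : posdefmx (W x). Proof. exact: W_weight.2. Qed.

Definition sqform (F : T -> 'M[R[i]]_q) x : R := Re (ntr (F x *m W x *m (F x)^t*)).

Lemma sqform_ge0 F x : 0 <= sqform F x.
Proof. exact: Re_ntr_form_ge0. Qed.

Lemma sqform_measurable F : mx_measurable F -> measurable_fun setT (sqform F).
Proof.
move=> mF; have [] // := cmeasurable_tr (mx_measurable_form W_weight mF mF).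
Qed.

Lemma sqform_integrable F : L2 mu W F -> mu.-integrable setT (EFin \o sqform F).
Proof. by case=> _ []. Qed.

Lemma integral_sqform F : L2 mu W F ->
  (\int[mu]_x (sqform F x)%:E)%E = (seminorm (Re_inner mu W) F ^+ 2)%:E.
Proof.
move=> LF; rewrite (sqr_seminorm (Re_inner_semi q_gt0 W_weight) LF).
rewrite (Re_innerE q_gt0 W_weight LF) /Rintegral fineK//.
by apply: integrable_fin_num => //; exact: sqform_integrable.
Qed.

Lemma L2_sqform F : mx_measurable F -> (\int[mu]_x (sqform F x)%:E < +oo)%E ->
  L2 mu W F.
Proof.
move=> mF Fi; split => //; split; last first.
  rewrite (_ : (fun x => _) = cst 0%:E) ?integrable0//.
  by apply/funext => x; rewrite ntr_form_Im.
apply/integrableP; split; first by apply/measurable_EFinP; exact: sqform_measurable.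
rewrite (_ : (\int[mu]_x _)%E = (\int[mu]_x (sqform F x)%:E)%E)//.
by apply: eq_integral => x _; rewrite /= ger0_norm// sqform_ge0.
Qed.

(** An upper estimate, common to all entries of an increment, of the bound
    that [form_bound] gives with t = 2^-n. This weight balances the squared
    norm of the increment, which will be at most 4^-n, against the fixed
    integrable trace of W^-1. *)
Definition increment_bound (u : nat -> T -> 'M[R[i]]_q) n x : R :=
  2 ^+ n * (q%:R * sqform (u n.+1 - u n) x) +
  2^-1 ^+ n * \sum_j Re (invw W x j j).

Lemma invw_diag_ge0 x j : 0 <= Re (invw W x j j).
Proof.
rewrite /invw -(invmx_form (Wpos x)); exact: form_diag_ge0.
Qed.

Lemma increment_bound_ge0 u n x : 0 <= increment_bound u n x.
Proof.
rewrite addr_ge0// mulr_ge0 ?exprn_ge0 ?invr_ge0//.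
  by rewrite mulr_ge0// sqform_ge0.
by apply: sumr_ge0 => j _; exact: invw_diag_ge0.
Qed.

Lemma increment_boundP (u : nat -> T -> 'M[R[i]]_q) n x i j :
  `|Re (u n.+1 x i j) - Re (u n x i j)| <= increment_bound u n x /\
  `|Im (u n.+1 x i j) - Im (u n x i j)| <= increment_bound u n x.
Proof.
pose D := u n.+1 x - u n x.
have t0 : 0 < 2^-1 ^+ n :> R by rewrite exprn_gt0// invr_gt0.
have := form_bound D (invmx (W x)) i j (Wpos x) t0; rewrite /= -entry_form//.
rewrite invmx_form// -exprVn invrK.
have -> : Re (D i j) = Re (u n.+1 x i j) - Re (u n x i j).
  by rewrite /D !mxE cReD; congr (_ + _); case: (u n x i j).
have -> : Im (D i j) = Im (u n.+1 x i j) - Im (u n x i j).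
  by rewrite /D !mxE cImD; congr (_ + _); case: (u n x i j).
have := form_diag_le_ntr D i q_gt0 (Wpos x).
have : Re (invmx (W x) j j) <= \sum_j Re (invw W x j j).
  rewrite (bigD1 j)//= lerDl; apply: sumr_ge0 => k _; exact: invw_diag_ge0.
rewrite /increment_bound -[sqform _ _]/(Re (ntr (D *m W x *m D^t*))).
have a0 : 0 <= Re ((D *m W x *m D^t*) i i) by exact: form_diag_ge0.
have b0 : 0 <= Re (invmx (W x) j j) by exact: invw_diag_ge0.
have t1 : 0 < 2 ^+ n :> R by rewrite exprn_gt0.
move: t0 t1 a0 b0; set a := Re _; set b := Re _; set r := Re (ntr _).
set s := \sum_j _; set t := 2^-1 ^+ n; set t' := 2 ^+ n => t0 t1 a0 b0 bs ar.
have h1 : t * b <= t * s by rewrite ler_pM2l.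
have h2 : t' * a <= t' * (q%:R * r) by rewrite ler_pM2l.
have h3 : 0 <= t * b by rewrite mulr_ge0// ltW.
have h4 : 0 <= t' * a by rewrite mulr_ge0// ltW.
by move=> [h5 h6]; split; [apply: le_trans h5 _|apply: le_trans h6 _]; lra.
Qed.

Variable u : nat -> T -> 'M[R[i]]_q.
Hypothesis Lu : forall n, L2 mu W (u n).
Hypothesis hu : forall n, seminorm (Re_inner mu W) (u n.+1 - u n) <= 2^-1 ^+ n.

Let H := Re_inner_semi q_gt0 W_weight.
Let LD n : L2 mu W (u n.+1 - u n) := domB H (Lu _) (Lu _).
Let B := increment_bound u.

Lemma increment_bound_integrable n : mu.-integrable setT (EFin \o B n).
Proof.
rewrite (_ : EFin \o _ = fun x =>
    ((2 ^+ n * q%:R)%:E * (sqform (u n.+1 - u n) x)%:E +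
    (2^-1 ^+ n)%:E * \sum_j (Re (invw W x j j))%:E)%E); last first.
  by apply/funext => x; rewrite sumEFin -!EFinM -EFinD -mulrA.
apply: integrableD => //; apply: integrableZl => //.
  exact: sqform_integrable.
by apply: integrable_sum => // j _; case: (W_iw.2 j j).
Qed.

Definition increment_const : R := q%:R + \int[mu]_x \sum_j Re (invw W x j j).

Lemma increment_bound_integral n :
  (\int[mu]_x (B n x)%:E <= (2^-1 ^+ n * increment_const)%:E)%E.
Proof.
have iW : mu.-integrable setT (EFin \o (fun x => \sum_j Re (invw W x j j))).
  rewrite (_ : EFin \o _ = fun x => (\sum_j (Re (invw W x j j))%:E)%E); last first.
    by apply/funext => x; rewrite /= sumEFin.
  by apply: integrable_sum => // j _; case: (W_iw.2 j j).
have iS := sqform_integrable (LD n).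
have -> : (\int[mu]_x (B n x)%:E =
    (2 ^+ n * q%:R)%:E * \int[mu]_x (sqform (u n.+1 - u n) x)%:E +
    (2^-1 ^+ n)%:E * \int[mu]_x (\sum_j Re (invw W x j j))%:E)%E.
  rewrite -integralZl// -integralZl// -integralD//; [|exact: integrableZl..].
  by apply: eq_integral => x _; rewrite -!EFinM -EFinD -mulrA.
rewrite (integral_sqform (LD n)) /increment_const /Rintegral.
rewrite -[X in (_ + _ * X <= _)%E]fineK; last exact: integrable_fin_num.
rewrite -!EFinM -EFinD lee_fin mulrDr lerD2r.
have -> : 2^-1 ^+ n * q%:R = 2 ^+ n * q%:R * (2^-1 ^+ n) ^+ 2 :> R.
  by rewrite expr2 mulrACA -exprMn mulfV// expr1n mul1r mulrC.
rewrite ler_pM2l; last by rewrite mulr_gt0 ?exprn_gt0 ?ltr0n.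
by rewrite ler_pXn2r ?nnegrE ?exprn_ge0// seminorm_ge0.
Qed.

Let S x := (\sum_(0 <= n <oo) (B n x)%:E)%E.

Let mB n : measurable_fun setT (EFin \o B n).
Proof. exact: measurable_int (increment_bound_integrable n). Qed.

Let B0 n x : (0 <= (B n x)%:E)%E.
Proof. by rewrite lee_fin increment_bound_ge0. Qed.

Let mS : measurable_fun setT S.
Proof.
by apply: (@ge0_emeasurable_sum _ _ _ _ _ xpredT) => *; [exact: B0|exact: mB].
Qed.

Let S0 x : (0 <= S x)%E.
Proof. exact: nneseries_ge0. Qed.

(** The integrals of the bounds form a geometric series, so almost
    everywhere the increments of all entries are summable. *)
Lemma increment_sum_integrable : mu.-integrable setT S.
Proof.
apply/integrableP; split; first exact: mS.
under eq_integral do rewrite gee0_abs//.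
rewrite integral_nneseries//.
apply: (@le_lt_trans _ _ (2 * increment_const)%:E); last exact: ltry.
have c0 : 0 <= increment_const.
  rewrite addr_ge0//; apply: Rintegral_ge0 => x _.
  by apply: sumr_ge0 => j _; exact: invw_diag_ge0.
apply: lime_le; first by apply: is_cvg_nneseries => *; apply: integral_ge0.
apply: nearW => n.
apply: (@le_trans _ _ (\sum_(0 <= k < n) (2^-1 ^+ k * increment_const)%:E)%E).
  by apply: lee_sum => k _; exact: increment_bound_integral.
by rewrite sumEFin lee_fin -mulr_suml ler_wpM2r// sum_half_expn.
Qed.

Let E := [set x | S x \is a fin_num].

Let mE : measurable E.
Proof. by rewrite -[E]setTI; exact: emeasurable_fin_num. Qed.

Let muE : mu (~` E) = 0.
Proof.
have [N [mN N0 EN]] := integrable_ae measurableT increment_sum_integrable.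
apply/eqP; rewrite eq_le measure_ge0 andbT -N0 le_measure ?inE//.
  exact: measurableC.
by apply: subset_trans EN => x /= Ex /(_ I).
Qed.

(* The entries are set to 0 where the sum of the bounds is infinite, a null
   set: the limit then exists everywhere and is measurable. *)
Let ReE n x i j := \1_E x * Re (u n x i j).
Let ImE n x i j := \1_E x * Im (u n x i j).

Let l x : 'M[R[i]]_q := \matrix_(i, j)
  ((limn (fun n => ReE n x i j)) +i* (limn (fun n => ImE n x i j))).

Let cvg_E x i j : cvgn (fun n => ReE n x i j) /\ cvgn (fun n => ImE n x i j).
Proof.
rewrite /ReE /ImE indicE; have [/set_mem Ex|_] := boolP (x \in E); last first.
  by split; under eq_fun do rewrite mul0r; exact: is_cvg_cst.
have sumB n : \sum_(0 <= k < n) B k x <= fine (S x).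
  rewrite -lee_fin fineK// -sumEFin.
  exact: (nneseries_lim_ge (u_ := fun k => (B k x)%:E) n).
split; apply: (cvgn_of_summable_increments _ sumB) => n; rewrite !mul1r.
- exact: (increment_boundP u n x i j).1.
- exact: (increment_boundP u n x i j).2.
Qed.

Let ccvg_l x i j : E x -> ccvg (fun n => u n x i j) (l x i j).
Proof.
move=> Ex; have [c1 c2] := cvg_E x i j; rewrite /ccvg mxE /=; split.
- by move: c1; rewrite /ReE indicE mem_set//; under eq_fun do rewrite mul1r.
- by move: c2; rewrite /ImE indicE mem_set//; under eq_fun do rewrite mul1r.
Qed.

Let ml : mx_measurable l.
Proof.
have mu_ n : mx_measurable (u n) by case: (Lu n).
have m1 : measurable_fun setT (\1_E : T -> R) by exact: measurable_indic.
move=> i j; split.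
- apply: (@measurable_fun_cvg _ _ _ _ (fun n x => ReE n x i j)) => [n|x _].
    by apply: measurable_funM => //; case: (mu_ n i j).
  by rewrite mxE /=; exact: (cvg_E x i j).1.
- apply: (@measurable_fun_cvg _ _ _ _ (fun n x => ImE n x i j)) => [n|x _].
    by apply: measurable_funM => //; case: (mu_ n i j).
  by rewrite mxE /=; exact: (cvg_E x i j).2.
Qed.

(** Fatou's lemma on E for the functions u (n + m) - u n with n fixed, whose
    norms are at most 2^-n + 2^-(n + 1) + ... . *)
Let fatou_bound n :
  (\int[mu]_x (sqform (l - u n) x)%:E <= ((2 * 2^-1 ^+ n) ^+ 2)%:E)%E.
Proof.
have mu_ n' : mx_measurable (u n') by case: (Lu n').
have mlu : mx_measurable (l - u n).
  have mNu : mx_measurable (- u n) by case: (domN H (Lu n)).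
  exact: (mx_measurableD ml mNu).
have mf F : mx_measurable F -> measurable_fun setT (EFin \o sqform F).
  by move=> mF; apply/measurable_EFinP; exact: sqform_measurable.
have f0 F x : (0 <= (EFin \o sqform F) x)%E by rewrite lee_fin sqform_ge0.
rewrite (@ge0_negligible_integral _ _ _ mu setT (~` E))//; last 3 first.
- exact: measurableC.
- exact: mf.
- by move=> x _; exact: f0.
rewrite setTD setCK.
pose f m := EFin \o sqform (u (n + m)%N - u n).
have fl x : E x -> f m x @[m --> \oo] --> (sqform (l - u n) x)%:E.
  move=> Ex; apply: cvg_EFin; first by near=> k.
  apply: (ccvg_ntr_form (W x) (s := fun m => (u (n + m)%N - u n) x) _).1 => i j.
  have subE (F G : T -> 'M[R[i]]_q) : (F - G) x i j = F x i j + - G x i j.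
    by rewrite !mxE.
  rewrite subE; under eq_fun do rewrite subE.
  apply: ccvgD; last exact: ccvg_cst.
  have [c1 c2] := ccvg_l i j Ex; split; under eq_fun do rewrite addnC.
  - exact: (cvg_comp _ (fun k => Re (u k x i j)) (cvg_addnr n) c1).
  - exact: (cvg_comp _ (fun k => Im (u k x i j)) (cvg_addnr n) c2).
rewrite (_ : (\int[mu]_(x in E) _)%E =
    (\int[mu]_(x in E) limn_einf (f^~ x))%E); last first.
  by apply: eq_integral => x /set_mem Ex; rewrite (cvg_limn_einf_sup (fl x Ex)).1.
have LD' m : L2 mu W (u (n + m)%N - u n) := domB H (Lu _) (Lu _).
apply: le_trans (fatou mu mE _ _) _.
- by move=> m; apply: measurable_funTS; apply: mf; case: (LD' m).
- by move=> m x _; exact: f0.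
rewrite limn_einf_lim; apply: lime_le; first exact: is_cvg_einfs.
apply: nearW => m.
apply: (@le_trans _ _ (\int[mu]_(x in E) f m x)%E).
  by apply: ereal_inf_lbound; exists m => /=.
apply: (@le_trans _ _ (\int[mu]_x f m x)%E).
  apply: ge0_subset_integral => //; first by apply: mf; case: (LD' m).
  by move=> x _; exact: f0.
rewrite (integral_sqform (LD' m)) lee_fin.
rewrite ler_pXn2r ?nnegrE ?seminorm_ge0 ?mulr_ge0 ?exprn_ge0//.
exact: (seminorm_telescope H Lu hu).
Unshelve. all: by end_near. Qed.

(** The estimate of the distance puts l - u n, hence l, in the weighted
    space. *)
Lemma L2_complete : exists2 l, L2 mu W l &
  forall n, seminorm (Re_inner mu W) (l - u n) <= 2 * 2^-1 ^+ n.
Proof.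
have Ll n : L2 mu W (l - u n).
  apply: L2_sqform; last exact: le_lt_trans (fatou_bound n) (ltry _).
  have mNu : mx_measurable (- u n) by case: (domN H (Lu n)).
  exact: (mx_measurableD ml mNu).
exists l; first by rewrite -(subrK (u 0%N) l); exact: (domD H (Ll 0%N) (Lu 0%N)).
move=> n; have := fatou_bound n; rewrite (integral_sqform (Ll n)) lee_fin.
by rewrite ler_pXn2r ?nnegrE ?seminorm_ge0 ?mulr_ge0 ?exprn_ge0.
Qed.

End completeness.

(** * Projection onto the closure of a left module *)

Section projection_module.
Context d (T : measurableType d) (R : realType) (mu : probability T R).
Context (q : nat) (q_gt0 : (0 < q)%N) (W : T -> 'M[R[i]]_q).
Hypothesis W_iw : inv_weight mu W.

Let W_weight : weight mu W. Proof. exact: W_iw.1. Qed.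
Let H := Re_inner_semi q_gt0 W_weight.

Record L2_module (N : set (T -> 'M[R[i]]_q)) : Prop := L2Module {
  modL2 : N `<=` L2 mu W;
  mod0 : N 0;
  modD : forall F G, N F -> N G -> N (F + G);
  modM : forall (A : 'M[R[i]]_q) F, N F -> N (fun x => A *m F x) }.

Lemma scale_fct_mull (z : R[i]) (F : T -> 'M[R[i]]_q) :
  z *: F = (fun x => z%:M *m F x).
Proof. by apply/funext => x; rewrite mul_scalar_mx. Qed.

Lemma modZ N (z : R[i]) F : L2_module N -> N F -> N (z *: F).
Proof. by move=> HN NF; rewrite scale_fct_mull; exact: (modM HN). Qed.

Lemma modN N F : L2_module N -> N F -> N (- F).
Proof. by move=> HN /(modZ (-1) HN); rewrite scaleN1r. Qed.

Lemma sub_L2closure N : L2_module N -> N `<=` L2closure mu W N.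
Proof.
move=> HN F NF; split; first exact: (modL2 HN).
move=> e e0; exists F => //; rewrite subrr.
have : (L2norm mu W (0 *: F))%:C = 0 :> R[i].
  by rewrite (L2normZ q_gt0 W_weight _ (modL2 HN NF)) normr0 mul0r.
by rewrite scale0r => -[->].
Qed.

(** Orthogonality for the real form on the left module N is matrix-valued
    orthogonality. To reach the closure, (F, A K) is computed with the
    adjoint of A moved onto F, so that K itself remains the limit of
    elements of N and continuity of the real form applies. *)
Lemma inner_L2closure N F K : L2_module N -> L2 mu W F ->
  (forall k, N k -> Re_inner mu W F k = 0) -> L2closure mu W N K ->
  inner mu W F K = 0.
Proof.
move=> HN LF h [LK clK].
have hN k : N k -> inner mu W F k = 0.
  move=> Nk; apply: (inner_eq0 q_gt0 W_weight LF (modL2 HN Nk)) => A.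
  by apply: h; exact: (modM HN).
apply: (inner_eq0 q_gt0 W_weight LF LK) => A.
have LAF := L2_mull q_gt0 W_weight (A^t*) LF.
have -> : Re_inner mu W F (fun x => A *m K x) =
    Re_inner mu W (fun x => A^t* *m F x) K.
  have LAK := L2_mull q_gt0 W_weight A LK.
  rewrite (ipC H LF LAK) (Re_inner_mull q_gt0 W_weight A LK LF).
  rewrite (Re_inner_mull q_gt0 W_weight (A^t*) LF LK).
  rewrite (inner_adj q_gt0 W_weight LF LK) -cReJ -ntr_adj adjmxM adjmxK.
  by rewrite /ntr mxtrace_mulC.
apply: (ip_closure H (modL2 HN) LAF LK clK) => k Nk.
rewrite (Re_inner_mull q_gt0 W_weight _ LF (modL2 HN Nk)) hN//.
by rewrite mulmx0 /ntr mxtrace0 mul0r.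
Qed.

Lemma orthoproj_exists N F : L2_module N -> L2 mu W F ->
  exists P, L2closure mu W N P /\
    forall K, L2closure mu W N K -> inner mu W (F - P) K = 0.
Proof.
move=> HN LF.
have [|P [LP clP oP]] := projection H (modL2 HN) (mod0 HN) (modD HN)
    (fun t u => @modZ N t%:C u HN) _ LF.
  move=> u Nu hu; apply: (L2_complete q_gt0 W_iw _ hu) => n.
  exact: (modL2 HN).
exists P; split; first by split.
by move=> K clK; exact: (inner_L2closure HN (domB H LF LP) oP clK).
Qed.

Lemma orthoprojP N F : L2_module N -> L2 mu W F ->
  let P := orthoproj mu W (L2closure mu W N) F in
  L2closure mu W N P /\ forall K, L2closure mu W N K -> inner mu W (F - P) K = 0.
Proof. by move=> HN LF; exact: xgetPex (orthoproj_exists HN LF). Qed.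

End projection_module.

(** * Trigonometric polynomials *)

Section trigonometric_polynomials.
Context (R : realType) (G : zmodType) (mu : probability (borel_dual R G) R).
Context (mu_haar : haar mu) (q : nat) (q_gt0 : (0 < q)%N).
Context (W : borel_dual R G -> 'M[R[i]]_q).
Hypothesis W_weight : weight mu W.
Implicit Types (S : set G).
Local Notation trig := (@trigpoly R G q).

Lemma char0 (x : dual R G) : x 0 = 1.
Proof.
have := char_morph x 0 0; rewrite addr0 => /eqP; rewrite -subr_eq0.
rewrite -{1}[x 0]mulr1 -mulrBr mulf_eq0 (negbTE (norm1_neq0 (char_norm1 x 0)))/=.
by rewrite subr_eq0 => /eqP <-.
Qed.

(** Sums of frequencies may contain repetitions; counting them rewrites two
    such sums over a common duplicate-free list. *)
Lemma sum_mulrn_count (V : nmodType) (s t : seq G) (F : G -> V) : uniq t ->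
  {subset s <= t} -> \sum_(g <- t) F g *+ count_mem g s = \sum_(g <- s) F g.
Proof.
move=> ut; elim: s => [|h s IH] st.
  by rewrite big_nil big1// => g _; rewrite mulr0n.
rewrite big_cons -IH; last by move=> g gs; apply: st; rewrite inE gs orbT.
have -> : F h = \sum_(g <- t) F g *+ (h == g).
  have ht : h \in t by apply: st; rewrite inE eqxx.
  rewrite (bigD1_seq h)//= eqxx mulr1n big1 ?addr0// => g gh.
  by rewrite eq_sym (negbTE gh) mulr0n.
by rewrite -big_split/=; apply: eq_bigr => g _; rewrite mulrnDr.
Qed.

Lemma trigpoly0 S : trig S 0.
Proof.
exists [::], (fun=> 0); split => //.
by apply/funext => x; rewrite big_nil.
Qed.

Lemma trigpolyD S F K : trig S F -> trig S K -> trig S (F + K).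
Proof.
move=> [s [A [sS ->]]] [t [B [tS ->]]].
exists (undup (s ++ t)), (fun g => A g *+ count_mem g s + B g *+ count_mem g t).
split; first by move=> g /=; rewrite mem_undup mem_cat => /orP[/sS|/tS].
apply/funext => x; apply: esym.
under eq_bigr do rewrite scalerDr -!scalerMnr.
rewrite big_split/= !sum_mulrn_count ?undup_uniq// => g.
- by rewrite mem_undup mem_cat => ->; rewrite orbT.
- by rewrite mem_undup mem_cat => ->.
Qed.

Lemma trigpoly_mull S (A : 'M[R[i]]_q) F : trig S F -> trig S (fun x => A *m F x).
Proof.
move=> [s [B [sS ->]]]; exists s, (fun g => A *m B g); split => //.
apply/funext => x; rewrite mulmx_sumr; apply: eq_bigr => g _.
by rewrite scalemxAr.
Qed.

Lemma trigpolyS S S' F : S `<=` S' -> trig S F -> trig S' F.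
Proof. by move=> SS' [s [A [sS ->]]]; exists s, A; split => // g /sS/SS'. Qed.

Lemma trigpoly_cst S (A : 'M[R[i]]_q) : S 0 -> trig S (cst A).
Proof.
move=> S0; exists [:: 0], (fun=> A); split; first by move=> g /=; rewrite inE => /eqP ->.
by apply/funext => x; rewrite big_seq1 char0 scale1r.
Qed.

Lemma trigpoly_split S F : trig (S `|` [set 0]) F ->
  exists A K, trig S K /\ F = cst A + K.
Proof.
move=> [s [A [sS ->]]].
exists (\sum_(g <- s | g == 0) A g),
  (fun x => \sum_(g <- [seq g <- s | g != 0]) (x : dual R G) g *: A g).
split.
  exists [seq g <- s | g != 0], A; split => // g /=.
  rewrite mem_filter => /andP[g0 /sS[//|g00]].
  by move: g0; rewrite g00 eqxx.
apply/funext => x; rewrite [LHS](bigID (fun g => g == 0)); congr (_ + _).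
  by apply: eq_bigr => g /eqP ->; rewrite char0 scale1r.
by rewrite big_filter.
Qed.

(** Characters have modulus 1, so the form takes the same values as at the
    constant A. *)
Lemma trigpoly_term_L2 (g : G) (A : 'M[R[i]]_q) :
  L2 mu W (fun x : borel_dual R G => (x : dual R G) g *: A).
Proof.
have [_ LA] := L2_cst W_weight A; split.
  apply: (@mx_measurable_ext _ _ _ _ _
    (fun i j (x : borel_dual R G) => (x : dual R G) g * A i j)).
    by move=> i j x; rewrite mxE.
  move=> i j; apply: cmeasurableM; last exact: cmeasurable_cst.
  exact: char_eval_measurable.
move: LA; congr (cintegrable _ _); apply/funext => x; congr ntr.
rewrite adjmxZ -!scalemxAl -scalemxAr scalerA.
by rewrite -[X in X *: _]/(x g * Num.conj (x g)) char_mulJ scale1r.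
Qed.

Lemma trigpoly_module S : L2_module mu W (trig S).
Proof.
split; [|exact: trigpoly0|exact: trigpolyD|exact: trigpoly_mull].
move=> _ [s [A [_ ->]]].
elim: s => [|g s IH].
  suff : L2 mu W (0 : borel_dual R G -> _).
    by congr (L2 _ _); apply/funext => x; rewrite big_nil.
  exact: L2_0.
have := L2D q_gt0 W_weight (trigpoly_term_L2 g (A g)) IH.
by congr (L2 _ _); apply/funext => x; rewrite big_cons.
Qed.

Lemma trigpoly_integral S F : S `<=` ~` [set 0] -> trig S F ->
  mx_integral mu F = 0.
Proof.
move=> S0 [s [A [sS ->]]]; apply/matrixP => i j; rewrite mxE [RHS]mxE.
rewrite (_ : (fun x => _) =
    fun x : borel_dual R G => \sum_(g <- s) A g i j * (x : dual R G) g).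
  rewrite cintegral_sum => [|g]; last by apply: cintegrableZ; exact: cintegrable_char.
  rewrite big_seq big1// => g gs; rewrite cintegralZ; last exact: cintegrable_char.
  by rewrite (cintegral_char mu_haar) ?mulr0//; apply/eqP; apply: S0; exact: sS.
apply/funext => x; rewrite summxE; apply: eq_bigr => g _.
by rewrite mxE mulrC.
Qed.

End trigonometric_polynomials.

(** * The inverse weight and the dual of a submodule *)

Section inverse_weight.
Context d (T : measurableType d) (R : realType) (mu : probability T R).
Context (q : nat) (q_gt0 : (0 < q)%N) (W : T -> 'M[R[i]]_q).
Hypothesis W_iw : inv_weight mu W.

Let W_weight : weight mu W. Proof. exact: W_iw.1. Qed.
Let Wpos x : posdefmx (W x). Proof. exact: W_weight.2. Qed.

Lemma weight_invw : weight mu (invw W).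
Proof. by split; [exact: W_iw.2|move=> x; exact: posdef_inv]. Qed.

Lemma L2_invw : L2 mu W (invw W).
Proof.
apply: L2_intro; first by apply: mx_integrable_measurable; exact: W_iw.2.
by move: W_iw.2; congr mx_integrable; apply/funext => x; rewrite /invw invmx_form.
Qed.

Lemma form_invw_mul (F G : T -> 'M[R[i]]_q) x :
  (F x *m W x) *m invw W x *m (G x *m W x)^t* = F x *m W x *m (G x)^t*.
Proof.
by rewrite /invw mulmxK ?posdef_unit// adjmxM posdef_herm// mulmxA.
Qed.

Lemma inner_invw_mul (F G : T -> 'M[R[i]]_q) :
  inner mu (invw W) (fun x => F x *m W x) (fun x => G x *m W x) = inner mu W F G.
Proof. by congr mx_integral; apply/funext => x; rewrite form_invw_mul. Qed.

Lemma L2_invw_mul (F : T -> 'M[R[i]]_q) : L2 mu W F ->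
  L2 mu (invw W) (fun x => F x *m W x).
Proof.
move=> [mF iF]; split.
  by apply: mx_measurableM => //; apply: mx_integrable_measurable; exact: W_iw.1.1.
by move: iF; congr cintegrable; apply/funext => x; rewrite form_invw_mul.
Qed.

(** The inverse weight represents the integral. *)
Lemma inner_invw_left (K : T -> 'M[R[i]]_q) :
  inner mu W (invw W) K = mx_integral mu (fun x => (K x)^t*).
Proof.
congr mx_integral; apply/funext => x.
by rewrite /invw mulVmx ?posdef_unit// mul1mx.
Qed.

Lemma L2_mx_integrable (K : T -> 'M[R[i]]_q) : L2 mu W K -> mx_integrable mu K.
Proof.
move=> LK; move: (mx_integrable_form q_gt0 W_weight LK L2_invw).
apply: mx_integrable_ext => i j x; exact: entry_form.
Qed.

Lemma inner_invw_cst (A : 'M[R[i]]_q) : inner mu W (invw W) (cst A) = A^t*.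
Proof. by rewrite inner_invw_left -[RHS](mx_integral_cst mu). Qed.

(** Multiplication by W identifies the orthogonal complement of M with the
    dual of M and sends W^-1 to the constant I. Since W^-1 is the sum of Q
    and of an element of this complement, I minus its projection is the
    image of Q. The projection in the statement is an arbitrary function
    with the defining property; it is compared with J0 through the norms of
    the residuals. *)
Lemma dual_residual (M : set (T -> 'M[R[i]]_q)) (Q : T -> 'M[R[i]]_q) :
  M `<=` L2 mu W -> M Q ->
  (forall K, M K -> inner mu W (invw W - Q) K = 0) ->
  L2norm mu (invw W) (cst 1%:M -
    orthoproj mu (invw W) (dual_module mu W M) (cst 1%:M)) = L2norm mu W Q.
Proof.
move=> ML2 MQ oQ; have LQ := ML2 _ MQ.
have wi := weight_invw; have H := Re_inner_semi q_gt0 wi.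
have H' := Re_inner_semi q_gt0 W_weight.
pose P := [set J | dual_module mu W M J /\ forall K, dual_module mu W M K ->
  inner mu (invw W) (cst 1%:M - J) K = 0].
pose J0 x := (invw W - Q) x *m W x.
have LWQ : L2 mu W (invw W - Q) := domB H' L2_invw LQ.
have IJ0 : cst 1%:M - J0 = (fun x => Q x *m W x).
  apply/funext => x; rewrite -[LHS]/(1%:M - (invmx (W x) - Q x) *m W x).
  by rewrite mulmxBl mulVmx ?posdef_unit// opprB addrC subrK.
have dJ0 : dual_module mu W M J0.
  split; first exact: L2_invw_mul.
  move=> F MF; transitivity (inner mu W F (invw W - Q)).
    congr mx_integral; apply/funext => x.
    by rewrite /J0 adjmxM posdef_herm// mulmxA.
  by rewrite (inner_adj q_gt0 W_weight LWQ (ML2 _ MF)) oQ// trmx0 map_mx0.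
have PJ0 : P J0.
  split => // K [LK dK]; rewrite IJ0 -[RHS](dK _ MQ); congr mx_integral.
  by apply/funext => x; rewrite /invw mulmxK// posdef_unit.
have [dJ oJ] : P (orthoproj mu (invw W) (dual_module mu W M) (cst 1%:M)).
  by apply: xgetPex; exists J0.
set J := orthoproj _ _ _ _ in dJ oJ *.
have L1 : L2 mu (invw W) (cst 1%:M) := L2_cst wi _.
have ip0 F K : inner mu (invw W) F K = 0 -> Re_inner mu (invw W) F K = 0.
  by rewrite /Re_inner => ->; rewrite /ntr mxtrace0 mul0r.
transitivity (L2norm mu (invw W) (cst 1%:M - J0)); last first.
  by rewrite IJ0 /L2norm inner_invw_mul.
have [LJ LJ0] := (dJ.1, dJ0.1).
have le1 := residual_min H L1 LJ LJ0 (ip0 _ _ (oJ _ dJ)) (ip0 _ _ (oJ _ dJ0)).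
have le2 := residual_min H L1 LJ0 LJ (ip0 _ _ (PJ0.2 _ dJ0)) (ip0 _ _ (PJ0.2 _ dJ)).
by apply/le_anti/andP; split; [exact: le1|exact: le2].
Qed.

End inverse_weight.

(** * The infimum *)

Section infimum.
Context (R : realType) (G : zmodType) (mu : probability (borel_dual R G) R).
Context (mu_haar : haar mu) (q : nat) (q_gt0 : (0 < q)%N).
Context (W : borel_dual R G -> 'M[R[i]]_q) (W_iw : inv_weight mu W).
Context (S : set G) (S_not0 : S `<=` ~` [set 0]).
Local Notation N := (@trigpoly R G q S).
Local Notation N0 := (@trigpoly R G q (S `|` [set 0])).
Local Notation nrm := (L2norm mu W).

Let W_weight : weight mu W. Proof. exact: W_iw.1. Qed.
Let H := Re_inner_semi q_gt0 W_weight.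
Let HN : L2_module mu W N. Proof. exact: trigpoly_module. Qed.
Let HN0 : L2_module mu W N0. Proof. exact: trigpoly_module. Qed.
Let Lcst A : L2 mu W (cst A) := L2_cst W_weight A.
Let LV : L2 mu W (invw W) := L2_invw W_iw.

Lemma inner_invw_trig K : trigmodule mu W S K -> inner mu W (invw W) K = 0.
Proof.
apply: (inner_L2closure q_gt0 W_iw HN LV) => k Nk.
rewrite /Re_inner (inner_invw_left W_iw) mx_integral_adj; last first.
  exact: (L2_mx_integrable q_gt0 W_iw (modL2 HN Nk)).
by rewrite (trigpoly_integral mu_haar S_not0 Nk) trmx0 map_mx0 /ntr mxtrace0 mul0r.
Qed.

Lemma cst_sub_trigmodule A K : trigmodule mu W S K ->
  trigmodule mu W (S `|` [set 0]) (cst A - K).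
Proof.
move=> [LK clK]; split; first exact: (domB H (Lcst A) LK).
move=> e e0; have [k Nk klt] := clK _ e0; exists (cst A - k).
  apply: trigpolyD; first by apply: trigpoly_cst; right.
  by apply: (modN HN0); apply: trigpolyS Nk => g; left.
have Lk := modL2 HN Nk.
rewrite L2norm_seminorm (_ : _ - _ = k - K); last first.
  by rewrite opprB addrC addrA subrK.
by rewrite (seminormBC H Lk LK).
Qed.

Lemma Re_inner_cst_trig A K : trigmodule mu W S K ->
  Re_inner mu W (invw W) (cst A - K) = Re (ntr A).
Proof.
move=> tK; rewrite (ipBr H (Lcst A) tK.1 LV).
rewrite /Re_inner (inner_invw_trig tK) (inner_invw_cst W_iw) ntr_adj cReJ.
by rewrite /ntr mxtrace0 mul0r subr0.
Qed.

Lemma residual_le A K : trigmodule mu W S K ->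
  nrm (cst A - P_ mu W S (cst A)) <= nrm (cst A - K).
Proof.
move=> tK; have [tP oP] := orthoprojP q_gt0 W_iw HN (Lcst A).
have ip0 F : trigmodule mu W S F ->
    Re_inner mu W (cst A - P_ mu W S (cst A)) F = 0.
  by move=> tF; rewrite /Re_inner oP// /ntr mxtrace0 mul0r.
exact: (residual_min H (Lcst A) tP.1 tK.1 (ip0 _ tP) (ip0 _ tK)).
Qed.

Variable Q : borel_dual R G -> 'M[R[i]]_q.
Hypothesis tQ : trigmodule mu W (S `|` [set 0]) Q.
Hypothesis oQ : forall K, trigmodule mu W (S `|` [set 0]) K ->
  inner mu W (invw W - Q) K = 0.

Lemma Re_inner_proj_invw F : trigmodule mu W (S `|` [set 0]) F ->
  Re_inner mu W Q F = Re_inner mu W (invw W) F.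
Proof.
move=> tF; apply/esym/eqP; rewrite -subr_eq0 -(ipBl H LV tQ.1 tF.1).
by rewrite /Re_inner oQ// /ntr mxtrace0 mul0r.
Qed.

(** The residual lies in M(S^0), where Q and W^-1 have the same inner
    products; with W^-1 the trace is that of A. *)
Lemma residual_lower A : ntr A = 1 ->
  1 <= nrm Q * nrm (cst A - P_ mu W S (cst A)).
Proof.
move=> A1; have [tP _] := orthoprojP q_gt0 W_iw HN (Lcst A).
set F := cst A - _; have tF : trigmodule mu W (S `|` [set 0]) F.
  exact: cst_sub_trigmodule.
apply: le_trans (cauchy_schwarz H tQ.1 tF.1).
by rewrite (Re_inner_proj_invw tF) (Re_inner_cst_trig A tP) A1.
Qed.

Lemma norm_proj_gt0 : 0 < nrm Q.
Proof.
have := residual_lower (ntr1 R q_gt0); rewrite lt_def sqrtr_ge0 andbT.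
by apply: contraTneq => ->; rewrite mul0r -ltNge ltr01.
Qed.

(** Take a polynomial A0 + K within e of Q, of norm at most |Q| + e. The
    real part of tr A0 is the product of Q with A0 + K, hence at least |Q|^2
    - e |Q|. Then A is A0 divided by its trace. *)
Lemma residual_upper (e : R) : 0 < e -> e < nrm Q ->
  exists A, ntr A = 1 /\
    nrm (cst A - P_ mu W S (cst A)) * (nrm Q * (nrm Q - e)) <= nrm Q + e.
Proof.
move=> e0 eQ; have [F N0F Flt] := tQ.2 _ e0.
have [A0 [K [NK FE]]] := trigpoly_split N0F.
have LF := modL2 HN0 N0F; have LQF : L2 mu W (Q - F) := domB H tQ.1 LF.
have tF := sub_L2closure q_gt0 W_iw HN0 N0F.
have tK := sub_L2closure q_gt0 W_iw HN (modN HN NK).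
rewrite -[K]opprK in FE.
set n := nrm Q in eQ *; have n0 : 0 < n := norm_proj_gt0.
have ne0 : 0 < n - e by rewrite subr_gt0.
have p0 : 0 <= n * (n - e) := mulr_ge0 (ltW n0) (ltW ne0).
have ReA0 : n * (n - e) <= Re (ntr A0).
  rewrite -(Re_inner_cst_trig A0 tK) -FE -(Re_inner_proj_invw tF).
  have -> : Re_inner mu W Q F = Re_inner mu W Q Q - Re_inner mu W Q (Q - F).
    by rewrite (ipBr H tQ.1 LF tQ.1) opprB addrC subrK.
  rewrite -(sqr_seminorm H tQ.1) -L2norm_seminorm -/n.
  have := cauchy_schwarz H tQ.1 LQF; rewrite -!L2norm_seminorm -/n => h.
  have h2 : n * nrm (Q - F) <= n * e by rewrite ler_pM2l// ltW.
  rewrite mulrBr -expr2 lerD2l lerN2; exact: le_trans h h2.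
have Re0 : 0 < Re (ntr A0) by apply: lt_le_trans ReA0; rewrite mulr_gt0// subr_gt0.
have c0 : ntr A0 != 0 by apply: contraTneq Re0 => ->; rewrite ltxx.
pose c := (ntr A0)^-1.
have tcK : trigmodule mu W S (- (c *: K)).
  apply: (sub_L2closure q_gt0 W_iw HN); apply: (modN HN).
  exact: (modZ c HN NK).
exists (c *: A0); split; first by rewrite ntrZ mulVf.
have nF : nrm F <= n + e.
  have -> : F = Q + (F - Q) by rewrite addrC subrK.
  apply: le_trans (seminormD H tQ.1 (domB H LF tQ.1)) _.
  by rewrite lerD2l (seminormBC H LF tQ.1) ltW.
have cF : nrm (cst (c *: A0) - - (c *: K)) = nrm (c *: F).
  by rewrite FE; congr L2norm; rewrite !opprK; exact: esym (scalerDr _ _ _).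
have h1 := residual_le (c *: A0) tcK; rewrite cF in h1.
have h2 : nrm (c *: F) * Re (ntr A0) <= nrm F.
  exact: (mulr_Re_le c0 (sqrtr_ge0 _) (L2normZ q_gt0 W_weight c LF)).
exact: (le_trans (ler_pM (sqrtr_ge0 _) p0 h1 ReA0) (le_trans h2 nF)).
Qed.

(** Let e tend to 0 in [residual_upper]. *)
Lemma residual_lbound (y : R) :
  (forall A, ntr A = 1 -> y <= nrm (cst A - P_ mu W S (cst A))) ->
  y <= (nrm Q)^-1.
Proof.
move=> hy; have := norm_proj_gt0; have := residual_upper.
move: (nrm Q) => n up n0.
have [y0|y0] := leP y 0; first by rewrite (le_trans y0)// invr_ge0 ltW.
have key e : 0 < e -> e < n -> y * (n * (n - e)) <= n + e.
  move=> e0 en; have [A [A1]] := up _ e0 en; apply: le_trans.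
  have ne0 : 0 < n - e by rewrite subr_gt0.
  by apply: ler_wpM2r; [exact: mulr_ge0 (ltW n0) (ltW ne0)|exact: hy].
rewrite -[leRHS]mul1r ler_pdivlMr//.
suff : y * n * n <= n by rewrite -{3}[n]mul1r ler_pM2r.
apply/ler_addgt0Pl => e e0.
have k0 : 0 < 1 + y * n := ltr_wpDr (mulr_ge0 (ltW y0) (ltW n0)) ltr01.
(* The second term absorbs the error 1 + y n per unit of d; the first keeps
   d below n. *)
pose d := Num.min (n / 2) (e / (1 + y * n)).
have d0 : 0 < d by rewrite lt_min !divr_gt0.
have dn : d < n.
  by rewrite gt_min; apply/orP; left; rewrite ltr_pdivrMr// ltr_pMr// ltr1n.
have de : d * (1 + y * n) <= e by rewrite -ler_pdivlMr// ge_min lexx orbT.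
have := key d d0 dn; move: de; rewrite !mulrBr !mulrDr mulr1 !mulrA; lra.
Qed.

End infimum.

Theorem theorem3p7 (R : realType) (G : zmodType)
    (lambda : probability (borel_dual R G) R) (lambda_haar : haar lambda)
    (q : nat) (q_gt0 : (0 < q)%N)
    (W : borel_dual R G -> 'M[R[i]]_q) (W_weight : inv_weight lambda W)
    (S : set G) (S_not0 : S `<=` ~` [set 0]) :
  ereal_inf [set (L2norm lambda W (cst A - P_ lambda W S (cst A)))%:E
            | A in [set A : 'M[R[i]]_q | ntr A = 1]] =
  ((L2norm lambda (invw W) (cst 1%:M - I_tilde lambda W S))%:E^-1)%E.
Proof.
have HN0 : L2_module lambda W (@trigpoly R G q (S `|` [set 0])).
  by apply: trigpoly_module => //; exact: W_weight.1.
have [Q [tQ oQ]] := orthoproj_exists q_gt0 W_weight HN0 (L2_invw W_weight).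
have -> : L2norm lambda (invw W) (cst 1%:M - I_tilde lambda W S) =
    L2norm lambda W Q.
  by apply: dual_residual => // K [].
have n0 := norm_proj_gt0 lambda_haar q_gt0 W_weight S_not0 tQ oQ.
rewrite inver gt_eqF//.
set X := [set _ | _ in _].
have lbX : ((L2norm lambda W Q)^-1%:E <= ereal_inf X)%E.
  apply: le_ereal_inf_tmp => _ [A A1 <-]; rewrite lee_fin -[leLHS]mul1r ler_pdivrMr//.
  by rewrite mulrC; apply: residual_lower.
have fX : ereal_inf X \is a fin_num.
  rewrite fin_numE; apply/andP; split.
    by rewrite -ltNye (lt_le_trans _ lbX)// ltNyr.
  rewrite -ltey; apply: (@le_lt_trans _ _
    (L2norm lambda W (cst 1%:M - P_ lambda W S (cst 1%:M)))%:E); last exact: ltry.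
  by apply: ereal_inf_lbound; exists 1%:M => //=; exact: ntr1.
apply/eqP; rewrite eq_le lbX andbT -(fineK fX) lee_fin.
apply: (residual_lbound lambda_haar q_gt0 W_weight S_not0 tQ oQ) => A A1.
by rewrite -lee_fin fineK//; apply: ereal_inf_lbound; exists A.
Qed.
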